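(* There is an absolute constant $C>0$ such that the following holds. Let $\gamma\in(0,1)$, $\xi\in(0,1/n]$, $\delta\in(0,1)$, and let $\widehat\pi$ be an optimal policy of the discounted MDP $(\widehat P,\widetilde r,\gamma)$. Then with probability at least $1-\delta$, $$\|V^{\widehat\pi}_\gamma-V^\star_\gamma\|_\infty\le\frac{1}{1-\gamma}\sqrt{\frac{C\log^3\!\big(\frac{SAn}{(1-\gamma)\delta\xi}\big)}{n}\Big(\|V^\star_\gamma\|_{\mathrm{sp}}+\|V^{\widehat\pi}_\gamma\|_{\mathrm{sp}}+1\Big)} .$$
   Context: $\mathcal S$ finite with $S$ states, $\mathcal A$ finite with $A$ actions; transition kernel $P$; known reward $r:\mathcal S\times\mathcal A\to[0,1]$. Policies stationary Markov; $P_\pi,r_\pi$ induced matrix/reward. Empirical kernel $\widehat P$: $n$ i.i.d. samples from each $P(\cdot|s,a)$, independent across pairs, $\widehat P(s'|s,a)$ = fraction equal to $s'$. Perturbed reward $\widetilde r=r+\Delta$, $\Delta(s,a)$ i.i.d. Uniform$[0,\xi]$ independent of the samples. $V^\pi_\gamma=(I-\gamma P_\pi)^{-1}r_\pi$ and $V^\star_\gamma=\max_\pi V^\pi_\gamma$ are computed in the true model $(P,r)$; an optimal policy of $(\widehat P,\widetilde r,\gamma)$ maximizes $(I-\gamma\widehat P_\pi)^{-1}\widetilde r_\pi$ elementwise. $\|x\|_{\mathrm{sp}}=\max x-\min x$. *)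

(* Defs.v *)
From HB Require Import structures.
From mathcomp Require Import all_boot all_order all_algebra.
From mathcomp Require Import all_classical all_reals all_analysis.
Set Implicit Arguments. Unset Strict Implicit. Unset Printing Implicit Defensive.
Import Order.TTheory GRing.Theory Num.Theory.
Local Open Scope ring_scope.
Local Open Scope classical_set_scope.

Section MDP.
Variables (R : realType) (S A : nat).

Definition kernel_ok (P : 'I_S -> 'I_A -> 'I_S -> R) : Prop :=
  (forall s a s', 0 <= P s a s') /\ (forall s a, \sum_(s' < S) P s a s' = 1).

Definition is_policy (pi : 'I_S -> 'I_A -> R) : Prop :=
  (forall s a, 0 <= pi s a) /\ (forall s, \sum_(a < A) pi s a = 1).

Definition Ppi (P : 'I_S -> 'I_A -> 'I_S -> R) (pi : 'I_S -> 'I_A -> R) : 'M[R]_S :=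
  \matrix_(s, s') \sum_(a < A) pi s a * P s a s'.

Definition rpi (r : 'I_S -> 'I_A -> R) (pi : 'I_S -> 'I_A -> R) : 'cV[R]_S :=
  \col_s \sum_(a < A) pi s a * r s a.

Definition Vpi (P : 'I_S -> 'I_A -> 'I_S -> R) (r : 'I_S -> 'I_A -> R) (gamma : R)
  (pi : 'I_S -> 'I_A -> R) : 'cV[R]_S :=
  invmx (1%:M - gamma *: Ppi P pi) *m rpi r pi.

(* V^*_gamma = max_pi V^pi_gamma (elementwise; the max is attained, so it is the sup) *)
Definition Vstar (P : 'I_S -> 'I_A -> 'I_S -> R) (r : 'I_S -> 'I_A -> R) (gamma : R)
  : 'cV[R]_S :=
  \col_s sup [set (Vpi P r gamma pi) s ord0 | pi in is_policy].

Definition optimal_policy (P : 'I_S -> 'I_A -> 'I_S -> R) (r : 'I_S -> 'I_A -> R)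
  (gamma : R) (pi : 'I_S -> 'I_A -> R) : Prop :=
  is_policy pi /\
  forall pi', is_policy pi' -> forall s, (Vpi P r gamma pi') s ord0 <= (Vpi P r gamma pi) s ord0.

Definition supnorm (x : 'cV[R]_S) : R := \big[Num.max/0]_(s < S) `|x s ord0|.

(* span seminorm: max x - min x = max_{s,t} (x s - x t) *)
Definition spnorm (x : 'cV[R]_S) : R :=
  \big[Num.max/0]_(s < S) \big[Num.max/0]_(t < S) (x s ord0 - x t ord0).

End MDP.

Section Sampling.
Context {R : realType} {S A n : nat} {d : measure_display} {Omega : measurableType d}.

Definition Phat (X : 'I_S -> 'I_A -> 'I_n -> Omega -> 'I_S) (w : Omega)
  : 'I_S -> 'I_A -> 'I_S -> R :=
  fun s a s' => (\sum_(i < n) ((X s a i w == s') : nat)%:R) / n%:R.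

Definition rtilde (r : 'I_S -> 'I_A -> R) (Delta : 'I_S -> 'I_A -> Omega -> R) (w : Omega)
  : 'I_S -> 'I_A -> R := fun s a => r s a + Delta s a w.

Definition sampling_model (Pr : probability Omega R) (P : 'I_S -> 'I_A -> 'I_S -> R)
  (xi : R) (X : 'I_S -> 'I_A -> 'I_n -> Omega -> 'I_S) (Delta : 'I_S -> 'I_A -> Omega -> R)
  : Prop :=
  (forall s a i s', measurable (X s a i @^-1` [set s'])) /\
  (forall s a, measurable_fun setT (Delta s a)) /\
  (forall s a i s', Pr (X s a i @^-1` [set s']) = (P s a s')%:E) /\
  (forall s a (B : set R), measurable B ->
     Pr (Delta s a @^-1` B) = (lebesgue_measure (B `&` (`[0%R, xi]%classic : set R)) * (xi^-1)%:E)%E) /\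
  (forall (E : 'I_S -> 'I_A -> 'I_n -> set 'I_S) (B : 'I_S -> 'I_A -> set R),
     (forall s a, measurable (B s a)) ->
     Pr [set w | (forall s a i, E s a i (X s a i w)) /\ (forall s a, B s a (Delta s a w))]
     = (\prod_(s < S) \prod_(a < A)
          ((\prod_(i < n) Pr (X s a i @^-1` E s a i)) * Pr (Delta s a @^-1` B s a)))%E).

End Sampling.

(* Main.v *)
Require Import Defs.
From HB Require Import structures.
From mathcomp Require Import all_boot all_order all_algebra.
From mathcomp Require Import all_classical all_reals all_analysis.
From mathcomp Require Import ring lra.
Import Order.TTheory GRing.Theory Num.Theory.
Local Open Scope ring_scope.
Local Open Scope classical_set_scope.

(** For a fixed policy pi put v = V^pi - min V^pi, with values in [0, B]. Since
    v = rbar + gamma P_pi v with |rbar| <= 1, the one-step variance of v telescopes: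
    gamma^2 Var(v) <= gamma^2 P_pi v^2 - v^2 + 2 B. Bernstein's inequality at the rows
    (s, pi s), in its AM-GM form, bounds gamma |(Phat - P) v| by this variance plus a constant,
    and Bernstein for v^2 replaces P_pi v^2 by Phat_pi v^2. Then |V^pi - Vhat^pi| plus a small
    multiple of v^2 is a subsolution of the empirical Bellman equation, whence
    |V^pi - Vhat^pi| = O(sqrt(ell B / n)) / (1 - gamma) as soon as ell B <= n; otherwise the
    claim is trivial. It is applied to an optimal policy and to pihat, and the two errors add up
    because Vhat^{pi*} <= Vhat^{pihat}.

    pihat depends on the samples. The random rewards make the optimality gap of the empirical
    MDP at least eta, polynomially small, with high probability. Clamping the value of a state
    s0 to a number v then gives an MDP independent of the samples at s0, and for v in an
    eps-net its greedy policy coincides with pihat off s0; a union bound over s0, the action at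
    s0 and the net yields Bernstein for pihat. The perturbations are discretized into N cells,
    so that all probabilities are finite sums over a product space; N does not enter the rate. *)

(** * Markov chains and Markov decision processes *)

Section SubstochasticChain.
Context {R : realType} {S : nat}.
Implicit Types (K : 'I_S -> 'I_S -> R) (D V W : 'I_S -> R) (gamma c : R).

(** Row sums may fall below one because clamping a state to a fixed value, as is done later, gives
    it a zero row. *)
Definition substochastic K :=
  (forall s s', 0 <= K s s') /\ (forall s, \sum_(s' < S) K s s' <= 1).

(** At a maximizer m of D with D m > 0 the K-average of D is at most D m, so (1 - gamma) D m <= c;
    if D m <= 0 the sign of c suffices. With c = 0 this is a comparison principle, with c > 0 a
    perturbation bound. *)
Lemma max_principle K gamma c D :
  substochastic K -> 0 <= gamma < 1 -> 0 <= c ->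
  (forall s, D s <= gamma * (\sum_(s' < S) K s s' * D s') + c) ->
  forall s, D s <= c / (1 - gamma).
Proof.
move=> [K0 K1] /andP[g0 g1] c0 HD s.
have [m _ Hm] := @Order.TotalTheory.arg_maxP _ _ 'I_S s xpredT D isT.
apply: (le_trans (Hm s isT)).
have g1' : 0 < 1 - gamma by rewrite subr_gt0.
rewrite ler_pdivlMr//.
have [Dm|Dm] := leP (D m) 0; first by apply: le_trans c0; rewrite mulr_le0_ge0// ltW.
suff : \sum_(s' < S) K m s' * D s' <= D m.
  move=> /(ler_wpM2l g0) Hs.
  have := HD m; lra.
apply: (@le_trans _ _ (\sum_(s' < S) K m s' * D m)).
  by apply: ler_sum => s' _; rewrite ler_wpM2l//; exact: (Hm s' isT).
by rewrite -mulr_suml ler_piMl// ltW.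
Qed.

Lemma unitmx_resolvent (M : 'M[R]_S) gamma :
  substochastic (fun s s' => M s s') -> 0 <= gamma < 1 ->
  (1%:M - gamma *: M) \in unitmx.
Proof.
(* [det0P] yields a left null vector, hence the transposition; then v = gamma M v, and the maximum
   principle for v and -v gives v = 0. *)
move=> HM Hg; rewrite unitmxE unitfE -det_tr; apply/det0P => -[v vn0 /(congr1 trmx)].
rewrite trmx_mul trmxK trmx0 mulmxBl mul1mx -scalemxAl => /eqP; rewrite subr_eq0 => /eqP Hv.
have Hs s : v ord0 s = gamma * \sum_(s' < S) M s s' * v ord0 s'.
  move/matrixP/(_ s ord0): Hv; rewrite !mxE => ->.
  by congr (_ * _); apply: eq_bigr => s' _; rewrite mxE.
have le0 (D : 'I_S -> R) : (forall s, D s = gamma * \sum_(s' < S) M s s' * D s') ->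
    forall s, D s <= 0.
  move=> HD s; rewrite -[leRHS](mul0r (1 - gamma)^-1).
  by apply: (max_principle _ _ _ _ HM Hg (lexx 0)) => t; rewrite addr0 -HD.
move/eqP: vn0; apply; apply/rowP => s; rewrite mxE; apply/eqP; rewrite eq_le.
rewrite (le0 (fun s => v ord0 s))//= -oppr_le0.
apply: (le0 (fun s => - v ord0 s)) => t; rewrite Hs -mulrN -sumrN; congr (_ * _).
by apply: eq_bigr => s' _; rewrite mulrN.
Qed.

Lemma chain_value_unique K gamma (rho V W : 'I_S -> R) :
  substochastic K -> 0 <= gamma < 1 ->
  (forall s, V s = rho s + gamma * \sum_(s' < S) K s s' * V s') ->
  (forall s, W s = rho s + gamma * \sum_(s' < S) K s s' * W s') ->
  V = W.
Proof.
move=> HK Hg.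
suff le (V1 V2 : 'I_S -> R) :
    (forall s, V1 s = rho s + gamma * \sum_(s' < S) K s s' * V1 s') ->
    (forall s, V2 s = rho s + gamma * \sum_(s' < S) K s s' * V2 s') ->
    forall s, V1 s <= V2 s.
  by move=> HV HW; apply/funext => s; apply/eqP; rewrite eq_le !le.
move=> H1 H2 s; rewrite -subr_le0 -[leRHS](mul0r (1 - gamma)^-1).
apply: (max_principle K gamma 0 (fun s => V1 s - V2 s)) => // t.
rewrite H1 H2 addr0.
under [X in _ <= _ * X]eq_bigr do rewrite mulrBr.
rewrite sumrB; lra.
Qed.

End SubstochasticChain.

(** * Bellman equations, optimal policies and their stability *)

Section MDPTheory.
Context {R : realType} {S A : nat}.
Implicit Types (K : 'I_S -> 'I_A -> 'I_S -> R) (rho : 'I_S -> 'I_A -> R).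
Implicit Types (V W : 'I_S -> R) (gamma : R) (f : {ffun 'I_S -> 'I_A}).

Definition subkernel K :=
  (forall s a s', 0 <= K s a s') /\ (forall s a, \sum_(s' < S) K s a s' <= 1).

Definition qval K rho gamma V (s : 'I_S) (a : 'I_A) : R :=
  rho s a + gamma * \sum_(s' < S) K s a s' * V s'.

Definition policy_value K rho gamma f V := forall s, V s = qval K rho gamma V s (f s).

(** Bellman optimality, written with a policy f that attains the maximum over actions. *)
Definition bellman K rho gamma f V :=
  policy_value K rho gamma f V /\ forall s a, qval K rho gamma V s a <= V s.

Definition det_policy f : 'I_S -> 'I_A -> R := fun s a => (a == f s)%:R.

Lemma det_policyP f : is_policy (det_policy f).
Proof.
split=> [s a|s]; first exact: ler0n.
rewrite (bigD1 (f s))//= /det_policy eqxx big1 ?addr0// => a /negbTE ->//.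
Qed.

Lemma kernel_ok_subkernel K : kernel_ok K -> subkernel K.
Proof. by move=> [K0 K1]; split=> // s a; rewrite K1. Qed.

Lemma substochastic_det K f : subkernel K -> substochastic (fun s => K s (f s)).
Proof. by move=> [K0 K1]; split=> [s s'|s]. Qed.

Lemma substochastic_pi K pi : subkernel K -> is_policy pi ->
  substochastic (fun s s' => \sum_(a < A) pi s a * K s a s').
Proof.
move=> [K0 K1] [p0 p1]; split=> [s s'|s]; first by apply: sumr_ge0 => a _; rewrite mulr_ge0.
rewrite exchange_big/= -(p1 s); apply: ler_sum => a _.
by rewrite -mulr_sumr ler_piMr.
Qed.

Lemma Vpi_eq K rho gamma pi : subkernel K -> is_policy pi -> 0 <= gamma < 1 ->
  forall s, (Vpi K rho gamma pi) s ord0 =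
    \sum_(a < A) pi s a * qval K rho gamma (fun s' => (Vpi K rho gamma pi) s' ord0) s a.
Proof.
move=> HK Hpi Hg s.
have U : 1%:M - gamma *: Ppi K pi \in unitmx.
  apply: unitmx_resolvent => //; have [H0 H1] := substochastic_pi _ _ HK Hpi.
  by split=> [t t'|t]; [rewrite mxE|under eq_bigr do rewrite mxE].
have := mulKVmx U (rpi rho pi); rewrite -/(Vpi K rho gamma pi).
rewrite mulmxBl mul1mx -scalemxAl => /matrixP/(_ s ord0).
move: (Vpi _ _ _ _) => v; rewrite !mxE => /eqP; rewrite subr_eq => /eqP ->.
rewrite /qval; under [RHS]eq_bigr do rewrite mulrDr mulrCA.
rewrite big_split/=; congr (_ + _); rewrite -mulr_sumr; congr (_ * _).
under eq_bigr => s' _ do rewrite mxE mulr_suml.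
rewrite exchange_big/=; apply: eq_bigr => a _; rewrite mulr_sumr.
by apply: eq_bigr => s' _; rewrite mulrA.
Qed.

Lemma Vpi_det K rho gamma f : subkernel K -> 0 <= gamma < 1 ->
  policy_value K rho gamma f (fun s => (Vpi K rho gamma (det_policy f)) s ord0).
Proof.
move=> HK Hg s; rewrite [LHS]Vpi_eq//; last exact: det_policyP.
rewrite (bigD1 (f s))//= {1}/det_policy eqxx mul1r big1 ?addr0// => a /negbTE af.
by rewrite /det_policy af mul0r.
Qed.

Lemma policy_value_unique K rho gamma f V W : subkernel K -> 0 <= gamma < 1 ->
  policy_value K rho gamma f V -> policy_value K rho gamma f W -> V = W.
Proof.
move=> HK Hg HV HW.
exact: (chain_value_unique _ _ (fun s => rho s (f s)) _ _ (substochastic_det _ f HK) Hg HV HW).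
Qed.

Lemma qvalB K rho gamma V W s a :
  qval K rho gamma V s a - qval K rho gamma W s a =
  gamma * \sum_(s' < S) K s a s' * (V s' - W s').
Proof.
rewrite /qval; under [in RHS]eq_bigr do rewrite mulrBr.
rewrite sumrB; lra.
Qed.

(** Policy improvement: take a deterministic policy with the largest total value. An action better
    than V at s, substituted there, would lower no value and strictly raise the one at s. *)
Lemma bellman_exists K rho gamma : (0 < A)%N -> subkernel K -> 0 <= gamma < 1 ->
  exists f, exists V, bellman K rho gamma f V.
Proof.
move=> A0 HK Hg.
pose val (f : {ffun 'I_S -> 'I_A}) s := (Vpi K rho gamma (det_policy f)) s ord0.
have valE f : policy_value K rho gamma f (val f) by apply: Vpi_det.
have [f _ Hf] := @Order.TotalTheory.arg_maxP _ _ {ffun 'I_S -> 'I_A} [ffun=> Ordinal A0]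
  xpredT (fun f => \sum_(s < S) val f s) isT.
exists f, (val f); split=> // s a; rewrite leNgt; apply/negP => Hlt.
pose g : {ffun 'I_S -> 'I_A} := [ffun t => if t == s then a else f t].
have HG : substochastic (fun t => K t (g t)) := substochastic_det _ _ HK.
have Hq t : val f t <= qval K rho gamma (val f) t (g t).
  rewrite /g ffunE; case: eqP => [->|_]; first exact: ltW.
  by rewrite -valE.
have Hge t : val f t <= val g t.
  rewrite -subr_le0 -[leRHS](mul0r (1 - gamma)^-1).
  apply: (max_principle _ _ 0 (fun t => val f t - val g t) HG) => // u.
  rewrite addr0 -(qvalB K rho) -valE.
  by rewrite lerB.
have Hs : val f s < val g s.
  rewrite (valE g) /g ffunE eqxx; apply: (lt_le_trans Hlt).
  rewrite -subr_ge0 qvalB mulr_ge0//; first by case/andP: Hg.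
  by apply: sumr_ge0 => s' _; rewrite mulr_ge0 ?subr_ge0//; case: HK.
have := Hf g isT; apply/negP; rewrite -ltNge.
rewrite (bigD1 s)//= [ltRHS](bigD1 s)//= ltr_leD//.
by apply: ler_sum => t _.
Qed.

Lemma bellman_ge_Vpi K rho gamma f V pi : subkernel K -> 0 <= gamma < 1 ->
  bellman K rho gamma f V -> is_policy pi ->
  forall s, (Vpi K rho gamma pi) s ord0 <= V s.
Proof.
move=> HK Hg [HV HO] Hpi s; rewrite -subr_le0 -[leRHS](mul0r (1 - gamma)^-1).
apply: (max_principle _ _ 0 (fun s => (Vpi K rho gamma pi) s ord0 - V s)
  (substochastic_pi _ _ HK Hpi)) => // t.
have [p0 p1] := Hpi.
rewrite Vpi_eq// addr0 -[V t in leLHS]mul1r -(p1 t) mulr_suml -sumrB.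
apply: (@le_trans _ _ (\sum_(a < A) pi t a * (gamma * \sum_(s' < S) K t a s' *
   ((Vpi K rho gamma pi) s' ord0 - V s')))).
  by apply: ler_sum => a _; rewrite -mulrBr ler_wpM2l// -(qvalB K rho) lerB.
rewrite le_eqVlt; apply/orP; left; apply/eqP.
under eq_bigr do rewrite mulrCA.
rewrite -mulr_sumr; congr (_ * _).
under [RHS]eq_bigr => s' _ do rewrite mulr_suml.
rewrite exchange_big/=; apply: eq_bigr => a _; rewrite mulr_sumr.
by apply: eq_bigr => s' _; rewrite mulrA.
Qed.

(** f is admissible, if not optimal, for the second rewards, so V - V' is a subsolution for the
    chain of f with constant c. Exchanging the roles gives the other sign. *)
Lemma bellman_dist K rho rho' gamma f f' V V' c : subkernel K -> 0 <= gamma < 1 ->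
  0 <= c -> (forall s a, `|rho s a - rho' s a| <= c) ->
  bellman K rho gamma f V -> bellman K rho' gamma f' V' ->
  forall s, `|V s - V' s| <= c / (1 - gamma).
Proof.
move=> HK Hg c0.
suff le rho1 rho2 f1 f2 V1 V2 : (forall s a, `|rho1 s a - rho2 s a| <= c) ->
    bellman K rho1 gamma f1 V1 -> bellman K rho2 gamma f2 V2 ->
    forall s, V1 s - V2 s <= c / (1 - gamma).
  move=> Hc H1 H2 s; rewrite ler_norml -lerN2 opprK opprB (le rho' rho f' f)//=.
    by rewrite (le rho rho' f f').
  by move=> t a; rewrite distrC.
move=> Hc [H1 _] [_ H2].
apply: (max_principle _ _ c (fun s => V1 s - V2 s) (substochastic_det _ f1 HK)) => // s.
have H2' := H2 s (f1 s); rewrite {1}H1.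
rewrite -(qvalB K rho2); have := Hc s (f1 s); rewrite ler_norml /qval => /andP[_].
rewrite /qval in H2'; lra.
Qed.

(** No randomized policy exceeds V, and [det_policy f] attains it, so the supremum is a maximum. *)
Lemma Vstar_bellman K rho gamma f V : subkernel K -> 0 <= gamma < 1 ->
  bellman K rho gamma f V -> forall s, (Vstar K rho gamma) s ord0 = V s.
Proof.
move=> HK Hg HB s; rewrite mxE.
have Vf : V = fun s => (Vpi K rho gamma (det_policy f)) s ord0.
  by apply: (policy_value_unique _ _ _ f _ _ HK Hg); [case: HB|apply: Vpi_det].
have ub : ubound [set (Vpi K rho gamma pi) s ord0 | pi in @is_policy R S A] (V s).
  by move=> _ [pi Hpi <-]; exact: (bellman_ge_Vpi _ _ _ _ _ _ HK Hg HB).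
have inV : [set (Vpi K rho gamma pi) s ord0 | pi in @is_policy R S A] (V s).
  by exists (det_policy f); [exact: det_policyP|rewrite Vf].
apply/eqP; rewrite eq_le; apply/andP; split.
  by apply: ge_sup => //; exists (V s).
by apply: ub_le_sup => //; exists (V s).
Qed.

Lemma optimal_policy_bellman K rho gamma f V pi : subkernel K -> 0 <= gamma < 1 ->
  bellman K rho gamma f V -> optimal_policy K rho gamma pi ->
  forall s, (Vpi K rho gamma pi) s ord0 = V s.
Proof.
move=> HK Hg HB [Hpi Hopt] s; apply/eqP; rewrite eq_le (bellman_ge_Vpi _ _ _ _ _ _ HK Hg HB)//=.
have -> : V = fun s => (Vpi K rho gamma (det_policy f)) s ord0.
  by apply: (policy_value_unique _ _ _ f _ _ HK Hg); [case: HB|apply: Vpi_det].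
exact/Hopt/det_policyP.
Qed.

(** V s is the pi-average of action values that never exceed V s, so pi puts no weight on an action
    strictly below it. This reduces a possibly randomized optimal policy to a deterministic one. *)
Lemma optimal_policy_unique_greedy K rho gamma f V pi : subkernel K -> 0 <= gamma < 1 ->
  bellman K rho gamma f V ->
  (forall s a, a != f s -> qval K rho gamma V s a < V s) ->
  optimal_policy K rho gamma pi -> pi = det_policy f.
Proof.
move=> HK Hg HB Hlt Hopt; have [[p0 p1] _] := Hopt.
have zero s a : a != f s -> pi s a = 0.
  move=> /Hlt qlt; have E := optimal_policy_bellman _ _ _ _ _ _ HK Hg HB Hopt.
  have := Vpi_eq K rho gamma pi HK (conj p0 p1) Hg s; rewrite E.
  have -> : (fun s' => (Vpi K rho gamma pi) s' ord0) = V by apply/funext.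
  rewrite -[V s in LHS]mul1r -(p1 s) mulr_suml => /eqP; rewrite -subr_eq0 -sumrB.
  rewrite psumr_eq0 => [/allP/(_ a)|a' _]; last first.
    by rewrite -mulrBr mulr_ge0// subr_ge0; case: HB.
  rewrite mem_index_enum -mulrBr mulf_eq0 subr_eq0 => /(_ isT).
  by rewrite [in X in _ || X]eq_sym (lt_eqF qlt) orbF => /eqP.
apply/funext => s; apply/funext => a; rewrite /det_policy.
have [->|/zero//] := eqVneq a (f s).
by have := p1 s; rewrite (bigD1 (f s))//= big1 ?addr0// => a' /zero.
Qed.

Lemma policy_value_bounds K rho gamma f V c : subkernel K -> 0 <= gamma < 1 ->
  (forall s a, 0 <= rho s a <= c) -> policy_value K rho gamma f V ->
  forall s, 0 <= V s <= c / (1 - gamma).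
Proof.
move=> HK Hg Hr HV s.
have c0 : 0 <= c by have /andP[] := Hr s (f s); exact: le_trans.
apply/andP; split.
  rewrite -oppr_le0 -[leRHS](mul0r (1 - gamma)^-1).
  apply: (max_principle _ _ 0 (fun s => - V s) (substochastic_det _ f HK)) => // t.
  under eq_bigr do rewrite mulrN.
  by rewrite {1}HV /qval sumrN; have := Hr t (f t); lra.
apply: (max_principle _ _ c V (substochastic_det _ f HK)) => // t.
by rewrite {1}HV /qval; have := Hr t (f t); lra.
Qed.

End MDPTheory.

(** * Bernstein bounds and the value of a fixed policy *)

Section Mean.
Context {R : realType} {T : finType}.
Implicit Types (p q f g : T -> R).

Definition mean p f : R := \sum_t p t * f t.

Definition variance p f : R := mean p (fun t => (f t - mean p f) ^+ 2).

Definition distribution_on p := (forall t, 0 <= p t) /\ \sum_t p t = 1.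

Lemma meanD p f g : mean p (fun t => f t + g t) = mean p f + mean p g.
Proof. by rewrite /mean -big_split/=; apply: eq_bigr => t _; rewrite mulrDr. Qed.

Lemma meanZ p c f : mean p (fun t => c * f t) = c * mean p f.
Proof. by rewrite /mean mulr_sumr; apply: eq_bigr => t _; rewrite mulrCA. Qed.

Lemma meanB p f g : mean p (fun t => f t - g t) = mean p f - mean p g.
Proof. by rewrite /mean -sumrB; apply: eq_bigr => t _; rewrite mulrBr. Qed.

Lemma mean_cst p c : distribution_on p -> mean p (fun=> c) = c.
Proof. by move=> [_ p1]; rewrite /mean -mulr_suml p1 mul1r. Qed.

Lemma mean_le p f g : distribution_on p -> (forall t, f t <= g t) -> mean p f <= mean p g.
Proof. by move=> [p0 _] fg; apply: ler_sum => t _; rewrite ler_wpM2l. Qed.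

Lemma mean_ge0 p f : distribution_on p -> (forall t, 0 <= f t) -> 0 <= mean p f.
Proof. by move=> [p0 _] f0; apply: sumr_ge0 => t _; rewrite mulr_ge0. Qed.

Lemma variance_ge0 p f : distribution_on p -> 0 <= variance p f.
Proof. by move=> Hp; apply: mean_ge0 => // t; rewrite sqr_ge0. Qed.

Lemma varianceE p f : distribution_on p ->
  variance p f = mean p (fun t => f t ^+ 2) - mean p f ^+ 2.
Proof.
move=> Hp; set c := mean p f.
have -> : variance p f = mean p (fun t => f t ^+ 2 - ((2 * c) * f t - c ^+ 2)).
  by congr (mean p _); apply/funext => t; rewrite -/c; ring.
rewrite meanB (meanB p (fun t => 2 * c * f t)) meanZ mean_cst// -/c; ring.
Qed.

End Mean.

Section Deviation.
Context {R : realType}.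

(* Bernstein for U and U ^ 2, where sigma = sqrt(ell B / n) and sqrt(ell Var(U) / n) has been
   split by AM-GM into variance and constant. *)
Definition deviation_ok {T : finType} (p q : T -> R) (gamma sigma B : R) (U : T -> R) :=
  gamma * `|mean q U - mean p U| <= sigma / B * gamma ^+ 2 * variance p U + 2 * sigma /\
  mean p (fun t => U t ^+ 2) - mean q (fun t => U t ^+ 2) <= variance p U / 2 + 16 * B.

Context {S A : nat}.
Variables (P Q : 'I_S -> 'I_A -> 'I_S -> R) (r e : 'I_S -> 'I_A -> R).
Variables (gamma xi sigma B m : R) (f : {ffun 'I_S -> 'I_A}) (V W : 'I_S -> R).

Lemma kernel_ok_distribution (K : 'I_S -> 'I_A -> 'I_S -> R) s a :
  kernel_ok K -> distribution_on (K s a).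
Proof. by move=> [K0 K1]; split. Qed.

(* V - m satisfies the Bellman equation with rewards in [-1, 1], so
   gamma^2 Var(V - m) telescopes along the chain up to O(B): adding the multiple
   2 sigma / B of (V - m)^2 to the error absorbs the variance terms. *)
Lemma policy_value_deviation :
  kernel_ok P -> kernel_ok Q -> 0 < gamma < 1 ->
  (forall s a, 0 <= r s a <= 1) -> (forall s a, 0 <= e s a <= xi) ->
  policy_value P r gamma f V -> policy_value Q (fun s a => r s a + e s a) gamma f W ->
  0 <= m -> (1 - gamma) * m <= 1 -> 1 <= B -> 0 <= sigma ->
  (forall s, 0 <= V s - m <= B) ->
  (forall s, deviation_ok (P s (f s)) (Q s (f s)) gamma sigma B (fun s => V s - m)) ->
  forall s, `|V s - W s| <= (38 * sigma + xi) / (1 - gamma).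
Proof.
move=> HP HQ /andP[g0 g1] Hr He HV HW m0 m1 B1 sg0 HU Hdev.
pose U s := V s - m.
have B0 : 0 < B by lra.
have sB0 : 0 <= sigma / B by rewrite divr_ge0// ltW.
have key s : sigma / B * gamma ^+ 2 * variance (P s (f s)) U <=
    2 * (sigma / B) * (gamma * mean (Q s (f s)) (fun t => U t ^+ 2) - U s ^+ 2) + 36 * sigma.
  have Dp : distribution_on (P s (f s)) by exact: kernel_ok_distribution.
  have Dq : distribution_on (Q s (f s)) by exact: kernel_ok_distribution.
  have [_ H2] := Hdev s.
  set v := variance _ _ in H2 *.
  have vE : v = _ := varianceE _ _ Dp.
  set x2 := mean (P s (f s)) _ in H2 vE.
  set y2 := mean (Q s (f s)) _ in H2 *.
  set x := mean _ _ in vE.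
  have y20 : 0 <= y2 by apply: mean_ge0 => // t; rewrite sqr_ge0.
  have xE : x = mean (P s (f s)) V - m by rewrite /x meanB mean_cst.
  pose rho := r s (f s) - (1 - gamma) * m.
  have uE : U s = rho + gamma * x.
    by rewrite /U HV /qval -/(mean _ V) xE /rho; ring.
  have rho1 : rho <= 1 by have := Hr s (f s); rewrite /rho; nra.
  have /andP[U0 UB] := HU s; rewrite -/(U s) in U0 UB.
  have v0 : 0 <= v by apply: variance_ge0.
  (* Since gamma x = U s - rho, gamma^2 v equals gamma^2 x2 - (U s - rho)^2. Replacing x2 by the
     empirical y2 costs v / 2, which moves to the left side and gives the factor 2; 18 B is 16 B
     from this replacement plus 2 B from the cross term. *)
  have H : gamma ^+ 2 * v <= 2 * (gamma * y2 - U s ^+ 2 + 18 * B).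
    have E : gamma ^+ 2 * v = gamma ^+ 2 * x2 - (U s - rho) ^+ 2 by rewrite vE uE; ring.
    have g2 : gamma ^+ 2 <= 1 by nra.
    have g20 : 0 <= gamma ^+ 2 by nra.
    have H3 : gamma ^+ 2 * (x2 - y2) <= gamma ^+ 2 * (v / 2 + 16 * B) by rewrite ler_wpM2l.
    have H4 : gamma ^+ 2 * B <= B by nra.
    have H5 : gamma ^+ 2 * y2 <= gamma * y2 by rewrite ler_wpM2r//; nra.
    have H6 : U s * rho <= B by nra.
    have H7 : 0 <= rho ^+ 2 by rewrite sqr_ge0.
    have H8 : (U s - rho) ^+ 2 = U s ^+ 2 - 2 * (U s * rho) + rho ^+ 2 by ring.
    lra.
  have tB : sigma / B * B = sigma by rewrite divfK// gt_eqF.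
  by have := ler_wpM2l sB0 H; lra.
move=> s; have xi0 : 0 <= xi by have /andP[/le_trans] := He s (f s); exact.
have c0 : 0 <= 38 * sigma + xi by lra.
(* b = 1 and b = -1 give the two signs. The drift under Q of the added potential 2 (sigma / B) U^2
   pays for the variance by [key]; 38 sigma is 36 sigma from [key] plus 2 sigma from the
   deviation. *)
have main (b : R) : `|b| = 1 -> forall s, b * (V s - W s) <= (38 * sigma + xi) / (1 - gamma).
  move=> b1 {}s; pose D s := b * (V s - W s) + 2 * (sigma / B) * U s ^+ 2.
  apply: (@le_trans _ _ (D s)); first by have := mulr_ge0 sB0 (sqr_ge0 (U s)); rewrite /D; lra.
  apply: (max_principle (fun s => Q s (f s)) gamma _ D _ _ c0).
  - exact/substochastic_det/kernel_ok_subkernel.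
  - by rewrite (ltW g0) g1.
  move=> t; rewrite -/(mean (Q t (f t)) D) /D meanD !meanZ meanB.
  have Dp : distribution_on (P t (f t)) by exact: kernel_ok_distribution.
  have Dq : distribution_on (Q t (f t)) by exact: kernel_ok_distribution.
  have [H1 _] := Hdev t; have H2 := key t.
  rewrite (meanB (Q t (f t)) V) (meanB (P t (f t)) V) !mean_cst// in H1.
  rewrite {1}HV {1}HW /qval -/(mean (P t (f t)) V) -/(mean (Q t (f t)) W).
  have /andP[e0 e1] := He t (f t).
  have bE : b * (mean (P t (f t)) V - mean (Q t (f t)) V) <=
      `|mean (Q t (f t)) V - m - (mean (P t (f t)) V - m)|.
    by rewrite (le_trans (ler_norm _))// normrM b1 mul1r distrC opprB addrA subrK.
  have be : - (b * e t (f t)) <= xi.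
    by rewrite (le_trans (ler_norm _))// normrN normrM b1 mul1r ger0_norm.
  have := ler_wpM2l (ltW g0) bE.
  lra.
rewrite ler_norml -lerN2 opprK; have := main 1 (normr1 _) s; rewrite mul1r => ->.
by have := main (-1) (normrN1 _) s; rewrite mulN1r => ->.
Qed.

End Deviation.

(** * Chernoff bounds for empirical means *)

Section Bernstein.
Context {R : realType} {T : finType}.
Implicit Types (p : T -> R).

(** Invert exp(-x) >= 1 - x and use (1 - x)(1 + x + 2 x^2) = 1 + x^2 (1 - 2 x) >= 1. *)
Lemma expR_le_quadratic (x : R) : x <= 1 / 2 -> expR x <= 1 + x + 2 * x ^+ 2.
Proof.
move=> x2; rewrite -[x in expR x]opprK expRN.
have H : 0 < 1 - x by lra.
apply: (@le_trans _ _ (1 - x)^-1).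
  by rewrite lef_pV2 ?posrE ?expR_gt0// expR_ge1Dx.
rewrite -[leLHS]mul1r ler_pdivrMr//.
have := sqr_ge0 x; nra.
Qed.

Lemma sum_predU_le {I : finType} (w : I -> R) (P P1 P2 : pred I) :
  (forall i, 0 <= w i) -> (forall i, P i -> P1 i || P2 i) ->
  \sum_(i | P i) w i <= \sum_(i | P1 i) w i + \sum_(i | P2 i) w i.
Proof.
move=> w0 HP; rewrite !(big_mkcond P) (big_mkcond P1) (big_mkcond P2) -big_split/=.
apply: ler_sum => i _; have := HP i; have := w0 i.
by case: (P i); case: (P1 i); case: (P2 i) => //= wi H; try lra; have := H isT.
Qed.

Lemma sum_predU3_le {I : finType} (w : I -> R) (P P1 P2 P3 : pred I) :
  (forall i, 0 <= w i) -> (forall i, P i -> [|| P1 i, P2 i | P3 i]) ->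
  \sum_(i | P i) w i <=
    \sum_(i | P1 i) w i + (\sum_(i | P2 i) w i + \sum_(i | P3 i) w i).
Proof.
move=> w0 HP; apply: (le_trans (sum_predU_le w P P1 (predU P2 P3) w0 HP)).
by rewrite lerD2l; apply: sum_predU_le.
Qed.

Lemma sum_pred_ex_le {I J : finType} (w : I -> R) (P : pred I) (Q : J -> pred I) :
  (forall i, 0 <= w i) -> (forall i, P i -> exists j, Q j i) ->
  \sum_(i | P i) w i <= \sum_j \sum_(i | Q j i) w i.
Proof.
move=> w0 HP; under [leRHS]eq_bigr do rewrite big_mkcond/=.
rewrite exchange_big/= (big_mkcond P); apply: ler_sum => i _.
have ge0 (j : J) : true -> 0 <= (if Q j i then w i else 0) by case: ifP.
case: ifPn => [/HP[j Qj]|_]; last exact: sumr_ge0.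
by rewrite (bigD1 j)//= Qj lerDl sumr_ge0// => k _; exact: ge0.
Qed.

Definition emp {n} (x : {ffun 'I_n -> T}) (t : T) : R :=
  (\sum_(i < n) ((x i == t) : nat)%:R) / n%:R.

Lemma mean_emp n (x : {ffun 'I_n -> T}) (Y : T -> R) :
  mean (emp x) Y = (\sum_(i < n) Y (x i)) / n%:R.
Proof.
rewrite /mean /emp; under eq_bigr do rewrite mulrAC mulr_suml.
rewrite -mulr_suml exchange_big/=; congr (_ / _); apply: eq_bigr => i _.
rewrite (bigD1 (x i))//= eqxx mul1r big1 ?addr0// => t /negbTE.
by rewrite eq_sym => ->; rewrite mul0r.
Qed.

Lemma emp_distribution n (x : {ffun 'I_n -> T}) : (0 < n)%N -> distribution_on (emp x).
Proof.
move=> n0; split=> [t|]; first by rewrite divr_ge0// sumr_ge0.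
have := mean_emp n x (fun=> 1); rewrite /mean; under eq_bigr do rewrite mulr1.
by move=> ->; rewrite sumr_const card_ord divff// pnatr_eq0 -lt0n.
Qed.

(** Chernoff's method with the quadratic bound on exp. theta stays free so that each application can
    balance the second moment against ell / (theta n). *)
Lemma emp_dev_prob p n (Y : T -> R) theta ell :
  distribution_on p -> (0 < n)%N -> 0 < theta -> (forall t, theta * Y t <= 1 / 2) ->
  \sum_(x : {ffun 'I_n -> T} |
      mean (emp x) Y - mean p Y >
        2 * theta * mean p (fun t => Y t ^+ 2) + ell / (theta * n%:R))
    \prod_(i < n) p (x i) <= expR (- ell).
Proof.
move=> Hp n0 th0 HY; have [p0 p1] := Hp.
have n0' : 0 < n%:R :> R by rewrite ltr0n.
set M2 := mean p (fun t => Y t ^+ 2).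
pose c := theta * mean p Y + 2 * theta ^+ 2 * M2.
have mgf : \sum_t p t * expR (theta * Y t) <= expR c.
  apply: (@le_trans _ _ (1 + c)); last exact: expR_ge1Dx.
  apply: (@le_trans _ _ (mean p (fun t => (1 + theta * Y t) + (2 * theta ^+ 2) * Y t ^+ 2))).
    apply: ler_sum => t _; rewrite ler_wpM2l//.
    by apply: (le_trans (expR_le_quadratic _ (HY t))); rewrite exprMn mulrA.
  by rewrite meanD (meanD _ (fun=> 1)) !meanZ mean_cst// /c addrA.
(* On the event the inserted factor is at least 1; off it the added terms are nonnegative. *)
apply: (@le_trans _ _ (\sum_(x : {ffun 'I_n -> T}) (\prod_(i < n) p (x i)) *
    (expR (- (n%:R * c) - ell) * \prod_(i < n) expR (theta * Y (x i))))).
  rewrite [leRHS](bigID (fun x : {ffun 'I_n -> T} =>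
      mean (emp x) Y - mean p Y > 2 * theta * M2 + ell / (theta * n%:R)))/=.
  apply: (@le_trans _ _ (\sum_(x : {ffun 'I_n -> T} |
      mean (emp x) Y - mean p Y > 2 * theta * M2 + ell / (theta * n%:R))
    (\prod_(i < n) p (x i)) *
    (expR (- (n%:R * c) - ell) * \prod_(i < n) expR (theta * Y (x i))))); last first.
    rewrite lerDl sumr_ge0// => x _.
    by rewrite !mulr_ge0 ?expR_ge0 ?prodr_ge0// => i _; exact: expR_ge0.
  apply: ler_sum => x Hx; rewrite ler_peMr ?prodr_ge0//.
  rewrite -expR_sum -expRD -[leLHS]expR0 ler_expR -mulr_sumr.
  have {}Hx : 2 * theta * M2 + ell / (theta * n%:R) <
      (\sum_(i < n) Y (x i)) / n%:R - mean p Y by rewrite -mean_emp.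
  have tn0 : 0 < theta * n%:R by rewrite mulr_gt0.
  have := ler_wpM2l (ltW tn0) (ltW Hx).
  rewrite mulrDr mulrBr [theta * n%:R * (ell / _)]mulrC divfK ?gt_eqF//.
  have -> : theta * n%:R * ((\sum_(i < n) Y (x i)) / n%:R) = theta * \sum_(i < n) Y (x i).
    by field; lra.
  rewrite /c; lra.
rewrite -[leRHS]mul1r.
under eq_bigr do rewrite mulrCA -big_split/=.
(* By independence the sum over samples is the n-th power of the one-sample moment generating
   function. *)
rewrite -mulr_sumr -(bigA_distr_bigA (fun (i : 'I_n) t => p t * expR (theta * Y t)))/=.
rewrite prodr_const card_ord.
rewrite mulrC expRD mulrA ler_wpM2r ?expR_ge0// expRN ler_pdivrMr ?expR_gt0// mul1r.
rewrite expRM_natl lerXn2r// nnegrE ?expR_ge0//.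
by apply: sumr_ge0 => t _; rewrite mulr_ge0 ?expR_ge0.
Qed.

(** A union of three Chernoff bounds: U - mu and mu - U give the first clause, mu^2 - U^2 the
    second. *)
Lemma deviation_prob p n (U : T -> R) gamma B ell :
  distribution_on p -> (0 < n)%N -> 0 < gamma < 1 -> 1 <= B -> 0 < ell ->
  ell * B <= n%:R -> (forall t, 0 <= U t <= B) ->
  \sum_(x : {ffun 'I_n -> T} |
      ~~ `[< deviation_ok p (emp x) gamma (Num.sqrt (ell * B / n%:R)) B U >])
    \prod_(i < n) p (x i) <= 3 * expR (- ell).
Proof.
move=> Hp n0 /andP[g0 g1] B1 l0 lB HU; have [p0 p1] := Hp.
have n0' : 0 < n%:R :> R by rewrite ltr0n.
have B0 : 0 < B by lra.
set sigma := Num.sqrt _.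
have sg2 : sigma ^+ 2 = ell * B / n%:R by rewrite sqr_sqrtr// divr_ge0// ?mulr_ge0// ltW.
have sg0 : 0 < sigma by rewrite sqrtr_gt0 divr_gt0// mulr_gt0.
have sg1 : sigma <= 1.
  by rewrite -(ler_pXn2r (n := 2))// ?nnegrE ?(ltW sg0)// sg2 expr1n ler_pdivrMr// mul1r.
set mu := mean p U; set v := variance p U.
(* This choice turns 2 theta v into gamma (sigma / B) v and ell / (theta n) into 2 sigma / gamma,
   which is the first clause once multiplied by gamma. *)
pose th1 := gamma * sigma / (2 * B).
have th10 : 0 < th1 by rewrite divr_gt0 ?mulr_gt0.
(* As (mu + U)^2 <= 4 B^2, the second moment of mu^2 - U^2 is at most 4 B^2 v; this theta makes the
   two terms at most v / 2 and 16 B. *)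
pose th2 := (16 * B ^+ 2)^-1.
have th20 : 0 < th2 by rewrite invr_gt0 mulr_gt0 ?exprn_gt0.
have mu0 : 0 <= mu by apply: mean_ge0 => // t; have /andP[] := HU t.
have muB : mu <= B.
  by rewrite -(mean_cst p B Hp); apply: mean_le => // t; have /andP[] := HU t.
have gs : gamma * sigma <= 1 by nra.
have bnd (y : R) : `|y| <= B -> th1 * y <= 1 / 2.
  move=> yB; apply: (@le_trans _ _ (th1 * B)).
    by rewrite ler_wpM2l ?(ltW th10)// (le_trans (ler_norm _)).
  by have -> : th1 * B = gamma * sigma / 2; [rewrite /th1; field; lra|lra].
have dU t : `|U t - mu| <= B by rewrite ler_norml; have := HU t; lra.
have w0 (x : {ffun 'I_n -> T}) : 0 <= \prod_(i < n) p (x i) by rewrite prodr_ge0.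
have E1 := emp_dev_prob p n (fun t => U t - mu) th1 ell Hp n0 th10 (fun t => bnd _ (dU t)).
have dU' t : `|mu - U t| <= B by rewrite distrC.
have E2 := emp_dev_prob p n (fun t => mu - U t) th1 ell Hp n0 th10 (fun t => bnd _ (dU' t)).
have sqB t : `|mu ^+ 2 - U t ^+ 2| <= B ^+ 2.
  by have := HU t; rewrite ler_norml; nra.
have bnd2 t : th2 * (mu ^+ 2 - U t ^+ 2) <= 1 / 2.
  apply: (@le_trans _ _ (th2 * B ^+ 2)).
    by rewrite ler_wpM2l ?(ltW th20)// (le_trans (ler_norm _)).
  by have -> : th2 * B ^+ 2 = 1 / 16; [rewrite /th2; field; lra|lra].
have E3 := emp_dev_prob p n (fun t => mu ^+ 2 - U t ^+ 2) th2 ell Hp n0 th20 bnd2.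
have -> : 3 * expR (- ell) = expR (- ell) + (expR (- ell) + expR (- ell)) :> R by ring.
apply: le_trans (lerD E1 (lerD E2 E3)).
apply: sum_predU3_le => // x; apply: contraR; rewrite !negb_or -!leNgt => /and3P[H1 H2 H3].
have De := emp_distribution _ x n0.
apply/asboolP; move: H1 H2 H3.
rewrite !(meanB _ U) !(meanB _ (fun=> mu)) !(meanB _ (fun=> mu ^+ 2)) !mean_cst// -/mu.
have -> : mean p (fun t => (U t - mu) ^+ 2) = v by [].
have -> : mean p (fun t => (mu - U t) ^+ 2) = v.
  by congr (mean p _); apply/funext => t; rewrite -/mu; ring.
have t1 : ell / (th1 * n%:R) = 2 * sigma / gamma.
  have -> : ell = sigma ^+ 2 * n%:R / B by rewrite sg2; field; lra.
  by rewrite /th1; field; lra.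
have t2 : 2 * th1 = gamma * (sigma / B) by rewrite /th1; field; lra.
rewrite t1 t2 => H1 H2 H3; split.
  rewrite -/mu -/v.
  have gK : gamma * (2 * sigma / gamma) = 2 * sigma by field; lra.
  move: H1 H2 gK; set q := 2 * sigma / gamma; set b := sigma / B => H1 H2 gK.
  case: (ger0P (mean (emp x) U - mu)) => _.
    by have := ler_wpM2l (ltW g0) H1; lra.
  by have := ler_wpM2l (ltW g0) H2; lra.
have M2 : mean p (fun t => (mu ^+ 2 - U t ^+ 2) ^+ 2) <= 4 * B ^+ 2 * v.
  rewrite -meanZ; apply: mean_le => // t.
  have -> : (mu ^+ 2 - U t ^+ 2) ^+ 2 = (mu + U t) ^+ 2 * (U t - mu) ^+ 2 by ring.
  rewrite ler_wpM2r ?sqr_ge0//; have := HU t; nra.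
have H4 := ler_wpM2l (ltW th20) M2.
have t3 : th2 * (4 * B ^+ 2 * v) = v / 4 by rewrite /th2; field; lra.
have t4 : ell / (th2 * n%:R) <= 16 * B.
  have -> : ell / (th2 * n%:R) = 16 * B * (ell * B / n%:R) by rewrite /th2; field; lra.
  rewrite ger_pMr ?mulr_gt0//; first by rewrite ler_pdivrMr ?mul1r.
rewrite -/v; lra.
Qed.

End Bernstein.

(** * Optimality gap and leave-one-out policies *)

Lemma sum_pairE {R : realType} {T1 T2 : finType} (E : pred (T1 * T2)) (F : T1 * T2 -> R) :
  \sum_(t | E t) F t = \sum_x \sum_(k | E (x, k)) F (x, k).
Proof.
rewrite big_mkcond; under [RHS]eq_bigr do rewrite big_mkcond/=.
by rewrite pair_bigA; apply: eq_bigr => -[].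
Qed.

(** * Finite product distributions *)

Section FiniteProduct.
Context {R : realType} {J T : finType} (mu : J -> T -> R).
Hypothesis mu_distr : forall j, distribution_on (mu j).

Definition prod_weight (z : {ffun J -> T}) : R := \prod_j mu j (z j).

Definition upd (z : {ffun J -> T}) (j0 : J) (t : T) : {ffun J -> T} :=
  [ffun j => if j == j0 then t else z j].

Lemma prod_weight_ge0 z : 0 <= prod_weight z.
Proof. by apply: prodr_ge0 => j _; case: (mu_distr j). Qed.

Lemma sum_prod_weight : \sum_z prod_weight z = 1.
Proof.
rewrite -(bigA_distr_bigA mu) big1// => j _; by case: (mu_distr j).
Qed.

Lemma upd_weight z j0 t : prod_weight (upd z j0 t) * mu j0 (z j0) = prod_weight z * mu j0 t.
Proof.
rewrite /prod_weight (bigD1 j0)//= [in RHS](bigD1 j0)//= ffunE eqxx.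
under eq_bigr => j /negbTE jj0 do rewrite ffunE jj0.
by ring.
Qed.

(* Fubini in one coordinate, through the involution (z, t) |-> (z with t at j0, z j0). *)
Lemma prod_weight_coord_le j0 (E : pred {ffun J -> T}) c :
  (forall z, \sum_(t | E (upd z j0 t)) mu j0 t <= c) ->
  \sum_(z | E z) prod_weight z <= c.
Proof.
move=> HE; have [_ m1] := mu_distr j0.
have -> : \sum_(z | E z) prod_weight z =
    \sum_(zt : {ffun J -> T} * T | E zt.1) prod_weight zt.1 * mu j0 zt.2.
  rewrite sum_pairE/= [LHS]big_mkcond; apply: eq_bigr => z _.
  by case: (E z); [rewrite -mulr_sumr m1 mulr1|rewrite big_pred0_eq].
pose phi (zt : {ffun J -> T} * T) := (upd zt.1 j0 zt.2, zt.1 j0).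
have phiK : involutive phi.
  move=> [z t]; rewrite /phi/= ffunE eqxx; congr pair; apply/ffunP => j.
  by rewrite !ffunE; case: eqP => // ->.
rewrite (reindex_inj (inv_inj phiK))/=.
under eq_bigr do rewrite upd_weight.
rewrite sum_pairE/= -[leRHS]mul1r -sum_prod_weight mulr_suml; apply: ler_sum => z _.
by rewrite -mulr_sumr ler_wpM2l ?prod_weight_ge0.
Qed.

End FiniteProduct.

Section PairSum.
Context {R : realType} {T1 T2 : finType} (w1 : T1 -> R) (w2 : T2 -> R).
Hypotheses (w1_distr : distribution_on w1) (w2_distr : distribution_on w2).

Lemma pair_sum_le_snd (E : pred (T1 * T2)) c :
  (forall x, \sum_(k | E (x, k)) w2 k <= c) ->
  \sum_(t | E t) w1 t.1 * w2 t.2 <= c.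
Proof.
case: w1_distr => w10 w11; move=> HE.
rewrite sum_pairE/= -[leRHS]mul1r -w11 mulr_suml; apply: ler_sum => x _.
by rewrite -mulr_sumr ler_wpM2l.
Qed.

Lemma pair_sum_le_fst (E : pred (T1 * T2)) c :
  (forall k, \sum_(x | E (x, k)) w1 x <= c) ->
  \sum_(t | E t) w1 t.1 * w2 t.2 <= c.
Proof.
case: w2_distr => w20 w21; move=> HE.
rewrite sum_pairE/=; under eq_bigr do rewrite big_mkcond/=.
rewrite exchange_big/= -[leRHS]mulr1 -w21 mulr_sumr; apply: ler_sum => k _.
by rewrite -big_mkcond -mulr_suml ler_wpM2r.
Qed.

Lemma pair_distribution : distribution_on (fun t : T1 * T2 => w1 t.1 * w2 t.2).
Proof.
case: w1_distr w2_distr => w10 w11 [w20 w21]; split=> [t|]; first exact: mulr_ge0.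
rewrite sum_pairE/= -w11; apply: eq_bigr => x _.
by rewrite -mulr_sumr w21 mulr1.
Qed.

End PairSum.

(** * Growth of the optimality gap with one reward *)

Section Gap.
Context {R : realType} {S A : nat}.
Implicit Types (K : 'I_S -> 'I_A -> 'I_S -> R) (rho : 'I_S -> 'I_A -> R).

(** All indices lie between the smallest and the largest; the 1 counts the second endpoint. This
    will count the reward cells at which the gap fails. *)
Lemma card_bounded_diameter N (B : pred 'I_N) (M : R) : 0 <= M ->
  (forall k1 k2 : 'I_N, B k1 -> B k2 -> (k1 < k2)%N -> k2%:R - k1%:R <= M) ->
  #|B|%:R <= M + 1.
Proof.
move=> M0 HB.
have [k0 Bk0|B0] := pickP B; last by rewrite (eq_card0 B0) addr_ge0.
have [k1 B1 H1] := arg_minnP (fun k : 'I_N => val k) Bk0.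
have [k2 B2 H2] := arg_maxnP (fun k : 'I_N => val k) Bk0.
have k12 : (k1 <= k2)%N := H1 _ B2.
have : (#|B| <= k2 - k1 + 1)%N.
  rewrite cardE -(size_map val) -(size_iota k1 (k2 - k1 + 1)).
  apply: uniq_leq_size; first by rewrite map_inj_uniq ?enum_uniq//; exact: val_inj.
  move=> _ /mapP[k + ->]; rewrite mem_enum => Bk.
  by rewrite mem_iota addnA subnKC// addn1 ltnS; apply/andP; split; [exact: H1|exact: H2].
rewrite -(ler_nat R) => /le_trans; apply; rewrite natrD lerD2r natrB//.
by move: k12; rewrite leq_eqVlt => /orP[/eqP ->|/HB]; [rewrite subrr|exact].
Qed.

(* Raising the reward of an optimal pair (s, a) raises V(s) the most, so the gap at s
   to every other action opens at rate at least 1 - gamma. *)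
Lemma bellman_gap_growth K rho1 rho2 gamma f1 f2 V1 V2 s a d :
  subkernel K -> 0 <= gamma < 1 -> 0 <= d ->
  (forall t b, rho2 t b = rho1 t b + (if (t, b) == (s, a) then d else 0)) ->
  bellman K rho1 gamma f1 V1 -> bellman K rho2 gamma f2 V2 ->
  V1 s = qval K rho1 gamma V1 s a -> V2 s = qval K rho2 gamma V2 s a ->
  forall a', a' != a -> qval K rho2 gamma V2 s a' + (1 - gamma) * d <= V2 s.
Proof.
move=> HK Hg d0 Hrho [P1 O1] [P2 O2] E1 E2 a' a'a.
have [K0 K1] := HK; have /andP[g0 g1] := Hg.
have sub (D : 'I_S -> R) M t b : 0 <= M -> (forall u, D u <= M) ->
    gamma * \sum_(s' < S) K t b s' * D s' <= gamma * M.
  move=> M0 DM; rewrite ler_wpM2l//.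
  apply: (@le_trans _ _ (\sum_(s' < S) K t b s' * M)).
    by apply: ler_sum => s' _; rewrite ler_wpM2l.
  by rewrite -mulr_suml ler_piMl.
pose D t := V2 t - V1 t.
have qD t b : qval K rho2 gamma V2 t b - qval K rho1 gamma V1 t b =
    gamma * (\sum_(s' < S) K t b s' * D s') + (if (t, b) == (s, a) then d else 0).
  have := qvalB K rho1 gamma V2 V1 t b; rewrite {1 3}/qval Hrho /D /qval; lra.
have D0 t : 0 <= D t.
  rewrite -oppr_le0 -[leRHS](mul0r (1 - gamma)^-1).
  apply: (max_principle _ _ 0 (fun t => - D t) (substochastic_det _ f1 HK)) => // u.
  have := qD u (f1 u); rewrite -P1; have := O2 u (f1 u).
  under [X in _ <= _ * X + _]eq_bigr do rewrite mulrN.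
  rewrite sumrN /D; case: ifP => _; lra.
have Ds : D s = gamma * (\sum_(s' < S) K s a s' * D s') + d.
  by rewrite /D {1}E2 {1}E1 qD eqxx.
(* Away from s the rewards agree, so a maximizer m of D other than s has D m <= gamma D m, hence D m
   <= 0 <= D s. *)
have Dle t : D t <= D s.
  have [m _ Hm] := @Order.TotalTheory.arg_maxP _ _ 'I_S t xpredT D isT.
  apply: (le_trans (Hm t isT)).
  have [->//|ms] := eqVneq m s.
  have Dm : D m <= gamma * D m.
    apply: le_trans (sub D (D m) m (f2 m) (D0 m) (fun u => Hm u isT)).
    have := qD m (f2 m); rewrite -P2 xpair_eqE (negbTE ms)/= /D.
    by have := O1 m (f2 m); lra.
  have : D m <= 0 by have := D0 m; nra.
  by move=> /le_trans; apply.
have := qD s a'; rewrite xpair_eqE (negbTE a'a) andbF.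
have := sub D (D s) s a' (D0 s) Dle; have := O1 s a'.
have : (1 - gamma) * d <= (1 - gamma) * D s.
  rewrite ler_wpM2l//; first lra.
  rewrite Ds lerDr mulr_ge0//; apply: sumr_ge0 => s' _; exact: mulr_ge0.
have : D s = V2 s - V1 s by []; lra.
Qed.

End Gap.

(** * Leave-one-out policies and the good event *)

Section LeaveOneOut.
Context {R : realType} {S A n N : nat} (gamma eta eps ell xi : R) (M : nat).
Context (P : 'I_S -> 'I_A -> 'I_S -> R) (r : 'I_S -> 'I_A -> R).
Context (sol : ('I_S -> 'I_A -> 'I_S -> R) -> ('I_S -> 'I_A -> R) ->
  {ffun 'I_S -> 'I_A} * ('I_S -> R)).
(** In the application [U g] is the true value of g minus its minimum and [B g] is its span plus
    one. Both depend on the policy alone, so they are fixed as soon as it is. *)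
Context (U : {ffun 'I_S -> 'I_A} -> 'I_S -> R) (B : {ffun 'I_S -> 'I_A} -> R).
Hypothesis sol_bellman : forall K rho, subkernel K ->
  bellman K rho gamma (sol K rho).1 (sol K rho).2.
Hypotheses (P_ok : kernel_ok P) (n_gt0 : (0 < n)%N) (N_gt0 : (0 < N)%N).
Hypotheses (gamma01 : 0 < gamma < 1) (eta0 : 0 < eta) (eps0 : 0 < eps).
Hypotheses (ell0 : 0 < ell) (xi0 : 0 < xi).
Hypotheses (B_ge1 : forall g, 1 <= B g) (U_bounds : forall g s, 0 <= U g s <= B g).

(* At each pair (s, a): the n samples, and the index k of the cell
   [k xi / N, (k + 1) xi / N) that contains the reward perturbation. *)
Definition sample_cell : finType := ({ffun 'I_n -> 'I_S} * 'I_N)%type.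

Definition outcome : finType := {ffun 'I_S * 'I_A -> sample_cell}.

Definition cell_weight (j : 'I_S * 'I_A) (t : sample_cell) : R :=
  (\prod_(i < n) P j.1 j.2 (t.1 i)) * N%:R^-1.

Definition emp_kernel (z : outcome) : 'I_S -> 'I_A -> 'I_S -> R :=
  fun s a => emp (z (s, a)).1.

Definition cell_reward (z : outcome) : 'I_S -> 'I_A -> R :=
  fun s a => r s a + xi * (z (s, a)).2%:R / N%:R.

(** A zero row together with the reward v forces the value at s0 to be v, whatever the action. *)
Definition clamp_kernel (K : 'I_S -> 'I_A -> 'I_S -> R) (s0 : 'I_S) :=
  fun s a s' => if s == s0 then 0 else K s a s'.

Definition clamp_reward (rho : 'I_S -> 'I_A -> R) (s0 : 'I_S) (v : R) :=
  fun s a => if s == s0 then v else rho s a.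

(* Independent of the outcome at (s0, a0); it equals the empirical optimal policy when a0 is
   that policy's action at s0 and v is close to the empirical optimal value at s0. *)
Definition loo_policy (z : outcome) (s0 : 'I_S) (a0 : 'I_A) (v : R) : {ffun 'I_S -> 'I_A} :=
  [ffun s => if s == s0 then a0
             else (sol (clamp_kernel (emp_kernel z) s0) (clamp_reward (cell_reward z) s0 v)).1 s].

(** The guard is the regime in which Bernstein's bound gives the required form; outside it the final
    bound is trivial. *)
Definition dev_event (g : {ffun 'I_S -> 'I_A}) (s : 'I_S) (x : {ffun 'I_n -> 'I_S}) :=
  ell * B g <= n%:R ->
  deviation_ok (P s (g s)) (emp x) gamma (Num.sqrt (ell * B g / n%:R)) (B g) (U g).

(** Conditioning on a being optimal at s isolates a single pair, so that its probability can be
    bounded by varying the reward at (s, a) only. *)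
Definition gap_at (z : outcome) (s : 'I_S) (a : 'I_A) :=
  let q := qval (emp_kernel z) (cell_reward z) gamma (sol (emp_kernel z) (cell_reward z)).2 s in
  (sol (emp_kernel z) (cell_reward z)).2 s = q a ->
  forall a', a' != a -> q a' + eta <= q a.

Lemma emp_kernel_ok z : kernel_ok (emp_kernel z).
Proof.
split=> s a; have [H0 H1] := @emp_distribution R _ n (z (s, a)).1 n_gt0; last exact: H1.
exact: H0.
Qed.

Lemma clamp_subkernel z s0 : subkernel (clamp_kernel (emp_kernel z) s0).
Proof.
have [K0 K1] := emp_kernel_ok z; split=> s a => [s'|]; rewrite /clamp_kernel; case: eqP => // _.
  by rewrite big1.
by rewrite K1.
Qed.

Lemma sample_distribution (j : 'I_S * 'I_A) :
  distribution_on (fun x : {ffun 'I_n -> 'I_S} => \prod_(i < n) P j.1 j.2 (x i)).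
Proof.
have [P0 P1] := P_ok; split=> [x|]; first exact: prodr_ge0.
by rewrite -(bigA_distr_bigA (fun _ => P j.1 j.2))/= big1.
Qed.

Lemma uniform_distribution : distribution_on (fun _ : 'I_N => N%:R^-1 : R).
Proof.
split=> [_|]; first by rewrite invr_ge0.
by rewrite sumr_const card_ord -[LHS]mulr_natr mulVf// pnatr_eq0 -lt0n.
Qed.

Lemma cell_weight_distribution j : distribution_on (cell_weight j).
Proof. exact: (pair_distribution _ _ (sample_distribution j) uniform_distribution). Qed.

Lemma cell_weight_le_snd j (E : pred sample_cell) c :
  (forall x, \sum_(k | E (x, k)) N%:R^-1 <= c) -> \sum_(t | E t) cell_weight j t <= c.
Proof. exact: (pair_sum_le_snd _ (fun=> N%:R^-1) (sample_distribution j)). Qed.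

Lemma cell_weight_le_fst j (E : pred sample_cell) c :
  (forall k, \sum_(x | E (x, k)) \prod_(i < n) P j.1 j.2 (x i) <= c) ->
  \sum_(t | E t) cell_weight j t <= c.
Proof.
exact: (pair_sum_le_fst (fun x : {ffun 'I_n -> 'I_S} => \prod_(i < n) P j.1 j.2 (x i)) _
  uniform_distribution).
Qed.

Lemma loo_policy_upd z s0 a0 v t : loo_policy (upd z (s0, a0) t) s0 a0 v = loo_policy z s0 a0 v.
Proof.
apply/ffunP => s; rewrite !ffunE; case: eqP => // /eqP ss0.
have -> : clamp_kernel (emp_kernel (upd z (s0, a0) t)) s0 = clamp_kernel (emp_kernel z) s0.
  apply/funext => u; apply/funext => b; apply/funext => u'; rewrite /clamp_kernel /emp_kernel.
  by case: eqVneq => // us0; rewrite ffunE xpair_eqE (negbTE us0).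
have -> // : clamp_reward (cell_reward (upd z (s0, a0) t)) s0 v = clamp_reward (cell_reward z) s0 v.
apply/funext => u; apply/funext => b; rewrite /clamp_reward /cell_reward.
by case: eqVneq => // us0; rewrite ffunE xpair_eqE (negbTE us0).
Qed.

(** Clamping s0 to its own value V s0 keeps V and f optimal. Replacing V s0 by v moves values by at
    most eps / (1 - gamma), less than half the gap, so the greedy action off s0 cannot change. *)
Lemma loo_policy_eq z s0 v (f := (sol (emp_kernel z) (cell_reward z)).1)
    (V := (sol (emp_kernel z) (cell_reward z)).2) :
  (forall s a, gap_at z s a) -> `|v - V s0| <= eps -> 2 * eps < (1 - gamma) * eta ->
  loo_policy z s0 (f s0) v = f.
Proof.
move=> Hgap vV Heps; have /andP[g0 g1] := gamma01.
have [VP VO] := sol_bellman _ (cell_reward z) (kernel_ok_subkernel _ (emp_kernel_ok z)).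
rewrite -/V -/f in VP VO.
set Kc := clamp_kernel (emp_kernel z) s0; set rc := clamp_reward (cell_reward z) s0.
have qc w W s a : s != s0 -> qval Kc (rc w) gamma W s a =
    qval (emp_kernel z) (cell_reward z) gamma W s a.
  by move=> /negbTE ss0; rewrite /qval /Kc /rc /clamp_kernel /clamp_reward ss0.
have qs0 w W a : qval Kc (rc w) gamma W s0 a = w.
  rewrite /qval /Kc /rc /clamp_kernel /clamp_reward eqxx big1 ?mulr0 ?addr0// => s' _.
  by rewrite mul0r.
have HV : bellman Kc (rc (V s0)) gamma f V.
  split=> [s|s a]; have [->|ss0] := eqVneq s s0; rewrite ?qs0 ?qc//.
have HW := sol_bellman Kc (rc v) (clamp_subkernel z s0).
have HWV := bellman_dist Kc (rc v) (rc (V s0)) gamma _ _ _ _ eps (clamp_subkernel z s0).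
have {}HWV : forall s, `|(sol Kc (rc v)).2 s - V s| <= eps / (1 - gamma).
  apply: HWV HW HV; rewrite ?(ltW g0) ?(ltW eps0)// => s a; rewrite /rc /clamp_reward.
  by case: eqP => // _; rewrite subrr normr0 ltW.
apply/ffunP => s; rewrite ffunE -/Kc -/(rc v); case: eqVneq => [->//|ss0].
apply/eqP; apply/negPn/negP => ne.
move: HW HWV ne; set W := (sol Kc (rc v)).2; set g := (sol Kc (rc v)).1 => -[HW _] HWV ne.
have := Hgap s (f s) (VP s) _ ne; rewrite -/V -VP -(qc v)//.
have := HWV s; rewrite ler_norml => /andP[+ _]; rewrite HW.
have : qval Kc (rc v) gamma W s (g s) - qval Kc (rc v) gamma V s (g s) <=
    gamma * (eps / (1 - gamma)).
  rewrite qvalB ler_wpM2l ?(ltW g0)//.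
  have [K0 K1] := clamp_subkernel z s0.
  apply: (@le_trans _ _ (\sum_(s' < S) Kc s (g s) s' * (eps / (1 - gamma)))).
    apply: ler_sum => s' _; apply: ler_wpM2l; first exact: K0.
    by rewrite (le_trans (ler_norm _)).
  rewrite -mulr_suml ler_piMl// divr_ge0 ?(ltW eps0)//; lra.
have : 2 * (eps / (1 - gamma)) < eta.
  by rewrite mulrA ltr_pdivrMr ?subr_gt0// [ltRHS]mulrC.
have : gamma * (eps / (1 - gamma)) <= eps / (1 - gamma).
  by rewrite ger_pMl ?(ltW g1)// divr_gt0 ?subr_gt0.
lra.
Qed.

(** Freeze everything but the cell index at (s, a). Between failing indices k1 < k2 the reward grows
    by d = xi (k2 - k1) / N and the gap by (1 - gamma) d, so k2 - k1 is at most N eta / (xi (1 -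
    gamma)). *)
Lemma gap_prob s a :
  \sum_(z | ~~ `[< gap_at z s a >]) prod_weight cell_weight z <=
    eta / (xi * (1 - gamma)) + N%:R^-1.
Proof.
have /andP[g0 g1] := gamma01.
have N0 : 0 < N%:R :> R by rewrite ltr0n.
apply: (prod_weight_coord_le _ cell_weight_distribution (s, a)) => z.
apply: cell_weight_le_snd => x.
set E := fun k : 'I_N => ~~ `[< gap_at (upd z (s, a) (x, k)) s a >].
rewrite -[X in X <= _]/(\sum_(k in E) N%:R^-1) sumr_const -[leLHS]mulr_natl.
rewrite ler_pdivrMr// mulrDl mulVf ?gt_eqF//.
apply: card_bounded_diameter.
  by rewrite mulr_ge0 ?(ltW N0)// divr_ge0 ?(ltW eta0)// mulr_ge0 ?(ltW xi0)// subr_ge0 ltW.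
(* From k1 only the optimality of a is kept; from k2 also an action a' within eta of it. *)
move=> k1 k2 /asboolPn/not_implyP[E1 _] /asboolPn/not_implyP[E2].
move=> /existsNP[a' /not_implyP[a'a /negP]]; rewrite -ltNge => Hlt k12.
have [z1 z1E] : exists z1, z1 = upd z (s, a) (x, k1) by exists (upd z (s, a) (x, k1)).
have [z2 z2E] : exists z2, z2 = upd z (s, a) (x, k2) by exists (upd z (s, a) (x, k2)).
rewrite -z1E in E1; rewrite -z2E in E2 Hlt.
have KE : emp_kernel z1 = emp_kernel z2.
  apply/funext => u; apply/funext => b; rewrite /emp_kernel z1E z2E !ffunE.
  by case: eqP.
rewrite KE in E1.
have HK := kernel_ok_subkernel _ (emp_kernel_ok z2).
pose d := xi * (k2%:R - k1%:R) / N%:R.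
have d0 : 0 <= d.
  by rewrite divr_ge0 ?ler0n// mulr_ge0 ?(ltW xi0)// subr_ge0 ler_nat ltnW.
have rE t b : cell_reward z2 t b =
    cell_reward z1 t b + (if (t, b) == (s, a) then d else 0).
  rewrite /cell_reward z1E z2E !ffunE; case: eqP => _ /=; last by rewrite addr0.
  by rewrite /d; field; lra.
have g01 : 0 <= gamma < 1 by rewrite (ltW g0) g1.
have := bellman_gap_growth _ _ _ _ _ _ _ _ s a d HK g01 d0 rE
  (sol_bellman _ _ HK) (sol_bellman _ _ HK) E1 E2 a' a'a.
rewrite E2 => /le_lt_trans/(_ Hlt); rewrite ltrD2l => H.
rewrite mulrAC ler_pdivlMr ?mulr_gt0 ?subr_gt0//.
have := ler_wpM2r (ltW N0) (ltW H).
have -> : (1 - gamma) * d * N%:R = (k2%:R - k1%:R) * (xi * (1 - gamma)).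
  by rewrite /d; field; lra.
by [].
Qed.

Lemma dev_event_prob g s :
  \sum_(x | ~~ `[< dev_event g s x >]) \prod_(i < n) P s (g s) (x i) <= 3 * expR (- ell).
Proof.
have [lB|lB] := leP (ell * B g) n%:R; last first.
  rewrite big_pred0 ?mulr_ge0 ?expR_ge0// => x; apply/negbTE; rewrite negbK.
  by apply/asboolP => H; move: lB; rewrite ltNge H.
have Dp := kernel_ok_distribution _ s (g s) P_ok.
apply: le_trans (deviation_prob _ n (U g) gamma (B g) ell Dp n_gt0 gamma01 (B_ge1 g) ell0 lB
  (U_bounds g)).
rewrite le_eqVlt; apply/orP; left; apply/eqP; apply: eq_bigl => x; congr (~~ _).
by apply/asbool_equiv_eq; split=> [/(_ lB)//|H _].
Qed.

Lemma fixed_policy_prob g s :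
  \sum_(z : outcome | ~~ `[< dev_event g s (z (s, g s)).1 >]) prod_weight cell_weight z <=
    3 * expR (- ell).
Proof.
apply: (prod_weight_coord_le _ cell_weight_distribution (s, g s)) => z.
apply: cell_weight_le_fst => k.
apply: le_trans (dev_event_prob g s).
by rewrite le_eqVlt; apply/orP; left; apply/eqP; apply: eq_bigl => x; rewrite ffunE eqxx.
Qed.

(** With the other coordinates frozen the policy is constant and plays a0 at s0, so the samples at
    (s0, a0) are fresh for it. *)
Lemma loo_policy_prob s0 a0 v :
  \sum_(z : outcome | ~~ `[< dev_event (loo_policy z s0 a0 v) s0 (z (s0, a0)).1 >])
    prod_weight cell_weight z <= 3 * expR (- ell).
Proof.
apply: (prod_weight_coord_le _ cell_weight_distribution (s0, a0)) => z.
apply: cell_weight_le_fst => k.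
have := dev_event_prob (loo_policy z s0 a0 v) s0; rewrite {2}/loo_policy ffunE eqxx.
apply: le_trans.
rewrite le_eqVlt; apply/orP; left; apply/eqP; apply: eq_bigl => x.
by rewrite loo_policy_upd ffunE eqxx.
Qed.

(** g0 will be an optimal policy of the true model, fixed before sampling. The last family runs over
    all clamped states, actions there and M grid values. *)
Definition good_outcome (g0 : {ffun 'I_S -> 'I_A}) : pred outcome := fun z =>
  [&& [forall sa : 'I_S * 'I_A, `[< gap_at z sa.1 sa.2 >]],
      [forall s, `[< dev_event g0 s (z (s, g0 s)).1 >]]
    & [forall saj : 'I_S * 'I_A * 'I_M,
        `[< dev_event (loo_policy z saj.1.1 saj.1.2 (saj.2%:R * eps)) saj.1.1
             (z (saj.1.1, saj.1.2)).1 >]]].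

Lemma good_outcome_prob g0 :
  1 - ((S * A)%:R * (eta / (xi * (1 - gamma)) + N%:R^-1) +
       (S%:R + (S * A * M)%:R) * (3 * expR (- ell))) <=
  \sum_(z | good_outcome g0 z) prod_weight cell_weight z.
Proof.
have w0 (z : outcome) := prod_weight_ge0 _ cell_weight_distribution z.
have := sum_prod_weight _ cell_weight_distribution.
rewrite (bigID (good_outcome g0))/= => tot.
rewrite lerBlDr -[leLHS]tot lerD2l {tot}.
apply: (le_trans (sum_predU3_le _ _
  (fun z => [exists sa : 'I_S * 'I_A, ~~ `[< gap_at z sa.1 sa.2 >]])
  (fun z => [exists s, ~~ `[< dev_event g0 s (z (s, g0 s)).1 >]])
  (fun z => [exists saj : 'I_S * 'I_A * 'I_M,
        ~~ `[< dev_event (loo_policy z saj.1.1 saj.1.2 (saj.2%:R * eps)) saj.1.1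
             (z (saj.1.1, saj.1.2)).1 >]]) w0 _)).
  by move=> z; rewrite /good_outcome !negb_and !negb_forall.
rewrite mulrDl; apply: lerD; [|apply: lerD].
- apply: (le_trans (sum_pred_ex_le _ _
    (fun (sa : 'I_S * 'I_A) z => ~~ `[< gap_at z sa.1 sa.2 >]) w0 _)).
    by move=> z /existsP.
  apply: (@le_trans _ _ (\sum_(sa : 'I_S * 'I_A) (eta / (xi * (1 - gamma)) + N%:R^-1))).
    by apply: ler_sum => sa _; exact: gap_prob.
  by rewrite sumr_const card_prod !card_ord [leRHS]mulr_natl.
- apply: (le_trans (sum_pred_ex_le _ _
    (fun s (z : outcome) => ~~ `[< dev_event g0 s (z (s, g0 s)).1 >]) w0 _)).
    by move=> z /existsP.
  apply: (@le_trans _ _ (\sum_(s < S) (3 * expR (- ell)))).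
    by apply: ler_sum => s _; exact: fixed_policy_prob.
  by rewrite sumr_const card_ord [leRHS]mulr_natl.
- apply: (le_trans (sum_pred_ex_le _ _
    (fun (saj : 'I_S * 'I_A * 'I_M) (z : outcome) =>
      ~~ `[< dev_event (loo_policy z saj.1.1 saj.1.2 (saj.2%:R * eps)) saj.1.1
             (z (saj.1.1, saj.1.2)).1 >]) w0 _)).
    by move=> z /existsP.
  apply: (@le_trans _ _ (\sum_(saj : 'I_S * 'I_A * 'I_M) (3 * expR (- ell)))).
    by apply: ler_sum => saj _; exact: loo_policy_prob.
  by rewrite sumr_const !card_prod !card_ord [leRHS]mulr_natl.
Qed.

Lemma good_outcome_gap g0 z : good_outcome g0 z -> forall s a, gap_at z s a.
Proof. by case/and3P => /forallP H _ _ s a; have /asboolP := H (s, a). Qed.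

Lemma good_outcome_fixed g0 z : good_outcome g0 z ->
  forall s, dev_event g0 s (z (s, g0 s)).1.
Proof. by case/and3P => _ /forallP H _ s; have /asboolP := H s. Qed.

(** Round V s down to a grid value j eps with j < M: the leave-one-out policy for s, f s and this
    value is f itself, so f inherits the deviation bound despite depending on the samples. *)
Lemma good_outcome_greedy g0 z (f := (sol (emp_kernel z) (cell_reward z)).1)
    (V := (sol (emp_kernel z) (cell_reward z)).2) :
  good_outcome g0 z -> 2 * eps < (1 - gamma) * eta ->
  (forall s, 0 <= V s < M%:R * eps) ->
  forall s, dev_event f s (z (s, f s)).1.
Proof.
move=> Hz Heps HV s; have /andP[V0 V1] := HV s.
have eV : 0 <= V s / eps by rewrite divr_ge0 ?(ltW eps0).
have /andP[j0 j1] := truncn_itv eV.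
have jM : (Num.truncn (V s / eps) < M)%N.
  by rewrite -(ltr_nat R); apply: (le_lt_trans j0); rewrite ltr_pdivrMr.
have /and3P[_ _ /forallP/(_ (s, f s, Ordinal jM))/asboolP/=] := Hz.
rewrite loo_policy_eq//; first exact: (good_outcome_gap _ _ Hz).
have /= j0' := ler_wpM2r (ltW eps0) j0; have j1' := ltW j1.
have {}j1' := ler_wpM2r (ltW eps0) j1'.
rewrite -/V ler_norml; move: j0' j1'; rewrite divfK ?gt_eqF// -natr1.
by lra.
Qed.

End LeaveOneOut.

(** * The sampling model *)

Section Norms.
Context {R : realType} {S : nat}.
Implicit Types (x : 'cV[R]_S).

Lemma supnorm_le x c : 0 <= c -> (forall s, `|x s ord0| <= c) -> supnorm x <= c.
Proof. by move=> c0 H; apply/bigmax_leP. Qed.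

Lemma spnorm_ge x s t : x s ord0 - x t ord0 <= spnorm x.
Proof.
apply: le_trans (le_bigmax _ (fun s => \big[Num.max/0]_(t < S) (x s ord0 - x t ord0)) s).
exact: (le_bigmax _ (fun t => x s ord0 - x t ord0) t).
Qed.

Lemma spnorm_ge0 x : 0 <= spnorm x.
Proof. exact: bigmax_ge_id. Qed.

Lemma spnorm_shift x : (0 < S)%N -> exists t, forall s, 0 <= x s ord0 - x t ord0 <= spnorm x.
Proof.
move=> S0; have [t _ Ht] := @Order.TotalTheory.arg_minP _ _ 'I_S (Ordinal S0) xpredT
  (fun s => x s ord0) isT.
by exists t => s; rewrite subr_ge0 (Ht s isT) spnorm_ge.
Qed.

End Norms.

(** * From the empirical to the true model *)

Section PlugIn.
Context {R : realType} {S A : nat}.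
Implicit Types (K P : 'I_S -> 'I_A -> 'I_S -> R) (rho r e : 'I_S -> 'I_A -> R).

(** This passes from the cell rewards to the actual perturbed ones: an error c moves values by at
    most c / (1 - gamma), less than half the gap, so f remains the unique greedy policy. *)
Lemma optimal_policy_of_gap K rho rho' gamma eta c f V pi :
  subkernel K -> 0 < gamma < 1 -> 0 <= c -> 2 * c < (1 - gamma) * eta ->
  (forall s a, 0 <= rho' s a - rho s a <= c) ->
  bellman K rho gamma f V ->
  (forall s a, a != f s -> qval K rho gamma V s a + eta <= V s) ->
  optimal_policy K rho' gamma pi ->
  pi = det_policy f /\ exists V', bellman K rho' gamma f V'.
Proof.
move=> HK /andP[g0 g1] c0 Hc Hrho HB Hgap Hopt.
have g01 : 0 <= gamma < 1 by rewrite (ltW g0) g1.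
(* Without actions the existence of f leaves no state, and all claims are vacuous. *)
have [A0|A0] := posnP A.
  have S0 : S = 0%N.
    apply/eqP; rewrite -leqn0 leqNgt; apply/negP => S0.
    by have := f (Ordinal S0); rewrite A0 => -[].
  have noS (s : 'I_S) : False by move: s; rewrite S0 => -[].
  split; first by apply/funext => s; case: (noS s).
  by exists V; split=> s; case: (noS s).
have [f' [V' HB']] := bellman_exists K rho' gamma A0 HK g01.
have HV := bellman_dist K rho' rho gamma f' f V' V c HK g01 c0.
have {}HV : forall s, `|V' s - V s| <= c / (1 - gamma).
  by apply: HV => // s a; rewrite ler_norml; have := Hrho s a; lra.
have k2 : 2 * (c / (1 - gamma)) < eta by rewrite mulrA ltr_pdivrMr ?subr_gt0// [ltRHS]mulrC.
have kE : c + gamma * (c / (1 - gamma)) = c / (1 - gamma) by field; lra.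
have Hlt s a : a != f s -> qval K rho' gamma V' s a < V' s.
  move=> af; have := Hgap s a af; have := HV s; rewrite ler_norml => /andP[+ _].
  have : qval K rho' gamma V' s a - qval K rho' gamma V s a <= gamma * (c / (1 - gamma)).
    rewrite qvalB ler_wpM2l ?(ltW g0)//; have [K0 K1] := HK.
    apply: (@le_trans _ _ (\sum_(s' < S) K s a s' * (c / (1 - gamma)))).
      by apply: ler_sum => s' _; apply: ler_wpM2l; rewrite // (le_trans (ler_norm _)).
    by rewrite -mulr_suml ler_piMl// divr_ge0//; lra.
  rewrite /qval; have := Hrho s a; lra.
have ff' : f' = f.
  apply/ffunP => s; apply/eqP/negPn/negP => /Hlt.
  by have [VP _] := HB'; rewrite -VP ltxx.
rewrite ff' in HB'.
by split; [exact: (optimal_policy_unique_greedy _ _ _ _ _ _ HK g01 HB')|exists V'].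
Qed.

(** With W the empirical value of fs, Vs - Vf = (Vs - W) + (W - V') + (V' - Vf). The middle term is
    nonpositive, the outer ones are fixed-policy errors, and Vf <= Vs settles the other sign. *)
Lemma plug_in_error P K r e gamma xi fs Vs f V' Vf (m B sigma : {ffun 'I_S -> 'I_A} -> R) :
  kernel_ok P -> kernel_ok K -> 0 < gamma < 1 ->
  (forall s a, 0 <= r s a <= 1) -> (forall s a, 0 <= e s a <= xi) ->
  bellman P r gamma fs Vs -> bellman K (fun s a => r s a + e s a) gamma f V' ->
  policy_value P r gamma f Vf ->
  (forall g V, (g = fs /\ V = Vs) \/ (g = f /\ V = Vf) ->
     [/\ 0 <= m g /\ (1 - gamma) * m g <= 1, 1 <= B g, 0 <= sigma g,
         forall s, 0 <= V s - m g <= B g &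
         forall s, deviation_ok (P s (g s)) (K s (g s)) gamma (sigma g) (B g)
                     (fun s => V s - m g)]) ->
  forall s, `|Vf s - Vs s| <= (38 * sigma fs + xi + (38 * sigma f + xi)) / (1 - gamma).
Proof.
move=> HP HK Hg Hr He HBs HB HVf H s.
have /andP[g0 g1] := Hg; have g01 : 0 <= gamma < 1 by rewrite (ltW g0) g1.
have HPs := kernel_ok_subkernel _ HP; have HKs := kernel_ok_subkernel _ HK.
have [VsP _] := HBs; have [VP' _] := HB.
have [[ms0 ms1] Bs ss Us Ds] := H fs Vs (or_introl (conj erefl erefl)).
have [[mf0 mf1] Bf sf Uf Df] := H f Vf (or_intror (conj erefl erefl)).
set rho := (fun s a => r s a + e s a) in HB VP'.
pose W s := (Vpi K rho gamma (det_policy fs)) s ord0.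
have WP : policy_value K rho gamma fs W by exact: Vpi_det.
have E1 := policy_value_deviation P K r e gamma xi (sigma fs) (B fs) (m fs) fs Vs W
  HP HK Hg Hr He VsP WP ms0 ms1 Bs ss Us Ds s.
have E2 := policy_value_deviation P K r e gamma xi (sigma f) (B f) (m f) f Vf V'
  HP HK Hg Hr He HVf VP' mf0 mf1 Bf sf Uf Df s.
have E3 : W s <= V' s := bellman_ge_Vpi _ _ _ _ _ _ HKs g01 HB (det_policyP fs) s.
have E4 : Vf s <= Vs s.
  have -> : Vf = fun s => (Vpi P r gamma (det_policy f)) s ord0.
    by apply: (policy_value_unique _ _ _ f _ _ HPs g01) => //; exact: Vpi_det.
  exact: (bellman_ge_Vpi _ _ _ _ _ _ HPs g01 HBs (det_policyP f)).
rewrite mulrDl; move: E1 E2; rewrite !ler_norml => /andP[E1 E1'] /andP[E2 E2'].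
by apply/andP; split; lra.
Qed.

End PlugIn.

(** * Discretization of the probability space *)

Section SampleSpace.
Context {R : realType} {S A n : nat} {d : measure_display} {Omega : measurableType d}.
Context {N : nat} {Pr : probability Omega R}.
Context {P : 'I_S -> 'I_A -> 'I_S -> R} {xi : R}.
Context {X : 'I_S -> 'I_A -> 'I_n -> Omega -> 'I_S} {Delta : 'I_S -> 'I_A -> Omega -> R}.
Hypotheses (N_gt0 : (0 < N)%N) (xi0 : 0 < xi).
Hypothesis model : sampling_model Pr P xi X Delta.

(** Half-open intervals are disjoint; together they cover [0, xi) and omit only a null endpoint. *)
Definition cell (k : 'I_N) : set R := `[xi * k%:R / N%:R, xi * k.+1%:R / N%:R[%classic.

Definition outcome_event (z : @outcome S A n N) : set Omega :=
  [set w | (forall s a i, [set (z (s, a)).1 i] (X s a i w)) /\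
           (forall s a, cell (z (s, a)).2 (Delta s a w))].

Lemma cell_prob s a k : Pr (Delta s a @^-1` cell k) = (N%:R^-1)%:E.
Proof.
have [_ [_ [_ [HD _]]]] := model.
have N0 : 0 < N%:R :> R by rewrite ltr0n.
rewrite HD; last exact: measurable_itv.
rewrite setIidl; last first.
  move=> x; rewrite /cell /= !in_itv/= => /andP[x1 x2]; apply/andP; split.
    by apply: le_trans x1; rewrite divr_ge0 ?mulr_ge0// ltW.
  apply: (le_trans (ltW x2)); rewrite ler_pdivrMr// ler_wpM2l ?ler_nat ?(ltW xi0)// ltn_ord.
rewrite /cell lebesgue_measure_itv/= lte_fin ltr_pM2r ?invr_gt0// ltr_pM2l// ltr_nat ltnSn.
rewrite -EFinD -EFinM; congr (_%:E); rewrite -natr1; field.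
by rewrite (gt_eqF N0) (gt_eqF xi0).
Qed.

Lemma outcome_event_measurable z : measurable (outcome_event z).
Proof.
have [HX [HD _]] := model.
have -> : outcome_event z =
    (\bigcap_(s in [set: 'I_S]) \bigcap_(a in [set: 'I_A])
      ((\bigcap_(i in [set: 'I_n]) (X s a i @^-1` [set (z (s, a)).1 i])) `&`
       (Delta s a @^-1` cell (z (s, a)).2))).
  apply/seteqP; split=> [w [H1 H2] s _ a _|w H]; first by split=> [i _|]; [exact: H1|exact: H2].
  by split=> [s a i|s a]; have [H1 H2] := H s I a I; [exact: H1|exact: H2].
apply: fin_bigcap_measurable; first exact: finite_finset.
move=> s _; apply: fin_bigcap_measurable; first exact: finite_finset.
move=> a _; apply: measurableI.
  by apply: fin_bigcap_measurable; [exact: finite_finset|move=> i _; exact: HX].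
by rewrite -[X in measurable X]setTI; apply: HD => //; exact: measurable_itv.
Qed.

Lemma outcome_event_prob z :
  Pr (outcome_event z) = (prod_weight (cell_weight P) z)%:E.
Proof.
have [_ [_ [HX [_ HI]]]] := model.
rewrite /outcome_event (HI (fun s a i => [set (z (s, a)).1 i]) (fun s a => cell (z (s, a)).2));
  last by move=> s a; exact: measurable_itv.
have EFprod (I : finType) (F : I -> R) : (\prod_i (F i)%:E = (\prod_i F i)%:E)%E.
  by apply: (big_ind2 (fun x y => x = y%:E)) => // x1 x2 y1 y2 -> ->.
under eq_bigr => s _.
  under eq_bigr => a _.
    under eq_bigr do rewrite HX.
    rewrite EFprod cell_prob -EFinM.
    over.
  rewrite EFprod.
  over.
rewrite EFprod pair_bigA /prod_weight; congr (_%:E).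
by apply: eq_bigr => -[s a] _.
Qed.

Lemma cell_inj (k k' : 'I_N) x : cell k x -> cell k' x -> k = k'.
Proof.
have N0 : 0 < N%:R :> R by rewrite ltr0n.
suff le (k1 k2 : 'I_N) : cell k1 x -> cell k2 x -> (k1 <= k2)%N.
  by move=> H H'; apply/val_inj/eqP; rewrite /= eqn_leq !le.
rewrite /cell/= !in_itv/= => /andP[H1 _] /andP[_ H2].
have := le_lt_trans H1 H2.
by rewrite ltr_pM2r ?invr_gt0// ltr_pM2l// ltr_nat ltnS.
Qed.

Lemma outcome_event_trivIset (D : set (@outcome S A n N)) : trivIset D outcome_event.
Proof.
move=> z z' _ _ [w [[X1 D1] [X2 D2]]]; apply/ffunP => -[s a].
apply/eqP; rewrite -pair_eqE; apply/andP; split; apply/eqP.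
  by apply/ffunP => i; rewrite -(X1 s a i) -(X2 s a i).
exact: cell_inj (D1 s a) (D2 s a).
Qed.

Lemma outcome_bigcup_prob (good : pred (@outcome S A n N)) :
  Pr (\bigcup_(z in [set` good]) outcome_event z) =
  (\sum_(z | good z) prod_weight (cell_weight P) z)%:E.
Proof.
rewrite measure_fin_bigcup.
- rewrite -sumEFin (@bigfs _ _ _ _ (index_enum _) good)//; first last.
  + by move=> z _; rewrite mem_index_enum.
  + exact: index_enum_uniq.
  by apply: eq_fsbigr => z _; exact: outcome_event_prob.
- exact: finite_finset.
- exact: outcome_event_trivIset.
- by move=> z _; exact: outcome_event_measurable.
Qed.

Lemma outcome_bigcup_measurable (good : pred (@outcome S A n N)) :
  measurable (\bigcup_(z in [set` good]) outcome_event z).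
Proof.
apply: fin_bigcup_measurable; first exact: finite_finset.
by move=> z _; exact: outcome_event_measurable.
Qed.

Lemma outcome_event_Phat z w : outcome_event z w -> @Phat R _ _ _ _ _ X w = emp_kernel z.
Proof.
move=> [HX _]; apply/funext => s; apply/funext => a; apply/funext => s'.
by rewrite /Phat /emp_kernel /emp; under eq_bigr do rewrite (HX s a _).
Qed.

Lemma outcome_event_Delta z w s a : outcome_event z w ->
  0 <= xi * (z (s, a)).2%:R / N%:R <= Delta s a w /\
  Delta s a w <= xi * (z (s, a)).2%:R / N%:R + xi / N%:R /\ Delta s a w <= xi.
Proof.
move=> [_ /(_ s a)]; have N0 : 0 < N%:R :> R by rewrite ltr0n.
rewrite /cell/= in_itv/= => /andP[D1 D2]; split.
  by rewrite D1 andbT divr_ge0 ?mulr_ge0// ltW.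
split; first by move: D2; rewrite -natr1 mulrDr mulr1 mulrDl => /ltW.
apply: (le_trans (ltW D2)); rewrite ler_pdivrMr// ler_wpM2l ?ler_nat ?(ltW xi0)// ltn_ord.
Qed.

End SampleSpace.

(** * Numerical constants and failure probability *)

Section Constants.
Context {R : realType}.

Lemma ln_ge_half (z : R) : 2 <= z -> 1 / 2 <= ln z.
Proof.
move=> z2; rewrite -ler_expR lnK ?posrE; last lra.
have := expR_le_quadratic (1 / 2 : R) (lexx _); lra.
Qed.

Lemma expR_Nln (z : R) k : 0 < z -> expR (- (k%:R * ln z)) = z ^- k.
Proof. by move=> z0; rewrite expRN expRM_natl lnK. Qed.

(** Each xi is absorbed by a square root, giving 39 (s1 + s2), with square at most 2 * 39^2 (s1^2 +
    s2^2). The cube enters through L <= 4 L^3, as L >= 1/2; the resulting factor 340704 is below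
    10^6. *)
Lemma rate_bound (n : nat) (L Bs Bf H xi : R) : (0 < n)%N -> 1 / 2 <= L ->
  1 <= Bs -> 1 <= Bf -> Bs + Bf <= 2 * H -> 0 < xi <= n%:R^-1 ->
  38 * Num.sqrt (14 * L * Bs / n%:R) + xi + (38 * Num.sqrt (14 * L * Bf / n%:R) + xi) <=
  Num.sqrt ((10 ^ 6)%:R * L ^+ 3 / n%:R * H).
Proof.
move=> n0 L0 B1 B2 BH /andP[x0 x1].
have n0' : 0 < n%:R :> R by rewrite ltr0n.
have n1 : 1 <= n%:R :> R by rewrite ler1n.
have H1 : 1 <= H by lra.
have sqE (B : R) : 1 <= B -> Num.sqrt (14 * L * B / n%:R) ^+ 2 = 14 * L * B / n%:R.
  by move=> B0; rewrite sqr_sqrtr// divr_ge0 ?mulr_ge0//; lra.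
have xile (B : R) : 1 <= B -> xi <= Num.sqrt (14 * L * B / n%:R).
  move=> B0; rewrite -(ler_pXn2r (n := 2))// ?nnegrE ?sqrtr_ge0 ?(ltW x0)// sqE//.
  apply: (@le_trans _ _ (n%:R^-1)).
    apply: (le_trans _ x1); rewrite expr2 ger_pMl//.
    by apply: (le_trans x1); rewrite invf_le1.
  rewrite -[leLHS]mul1r ler_wpM2r ?invr_ge0 ?(ltW n0')//; nra.
have := xile _ B1; have := xile _ B2; have := sqE _ B1; have := sqE _ B2.
have := sqrtr_ge0 (14 * L * Bs / n%:R); have := sqrtr_ge0 (14 * L * Bf / n%:R).
set s1 := Num.sqrt _; set s2 := Num.sqrt (14 * L * Bs / _) => s10 s20 E1 E2 x2 x3.
rewrite -ler_sqr ?nnegrE ?sqrtr_ge0//; last lra.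
rewrite sqr_sqrtr; last by rewrite mulr_ge0 ?divr_ge0 ?mulr_ge0 ?exprn_ge0 ?ler0n//; lra.
apply: (@le_trans _ _ ((39 * (s1 + s2)) ^+ 2)).
  by rewrite ler_sqr ?nnegrE; lra.
apply: (@le_trans _ _ (2 * 39 ^+ 2 * (s1 ^+ 2 + s2 ^+ 2))).
  have := sqr_ge0 (s1 - s2); nra.
rewrite E1 E2 natrX.
have -> : 2 * 39 ^+ 2 * (14 * L * Bf / n%:R + 14 * L * Bs / n%:R) =
  2 * 39 ^+ 2 * 14 * (L * (Bs + Bf)) / n%:R by field; lra.
have -> : 10%:R ^+ 6 * L ^+ 3 / n%:R * H = 10%:R ^+ 6 * (L ^+ 3 * H) / n%:R by field; lra.
rewrite ler_wpM2r ?invr_ge0 ?(ltW n0')//.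
have LL : L <= 4 * L ^+ 3 by nra.
have LH : L * (Bs + Bf) <= L * (2 * H) by rewrite ler_wpM2l//; lra.
have LLH : L * H <= 4 * L ^+ 3 * H by rewrite ler_wpM2r//; lra.
have L3 : 0 <= L ^+ 3 * H by rewrite mulr_ge0 ?exprn_ge0//; lra.
lra.
Qed.

Lemma rate_trivial (n : nat) (L Bs Bf H : R) : (0 < n)%N -> 1 / 2 <= L ->
  1 <= Bs -> 1 <= Bf -> Bs + Bf <= 2 * H -> n%:R < 14 * L * Bs + 14 * L * Bf ->
  1 <= Num.sqrt ((10 ^ 6)%:R * L ^+ 3 / n%:R * H).
Proof.
move=> n0 L0 B1 B2 BH Hn.
have n0' : 0 < n%:R :> R by rewrite ltr0n.
apply: (@le_trans _ _ (Num.sqrt 1)); first by rewrite sqrtr1.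
apply: ler_wsqrtr.
have LL : L <= 4 * L ^+ 3 by nra.
have LH : L * (Bs + Bf) <= L * (2 * H) by rewrite ler_wpM2l//; lra.
have LLH : L * H <= 4 * L ^+ 3 * H by rewrite ler_wpM2r//; lra.
have L3 : 0 <= L ^+ 3 * H by rewrite mulr_ge0 ?exprn_ge0//; lra.
rewrite mulrAC ler_pdivlMr// natrX; lra.
Qed.

End Constants.

Section Confidence.
Context {R : realType}.

Lemma confidence_arg_ge2 (k n : nat) (gamma delta xi : R) :
  (1 < k)%N -> (0 < n)%N -> 0 < gamma < 1 -> 0 < delta < 1 -> 0 < xi <= 1 ->
  2 <= (k * n)%:R / ((1 - gamma) * delta * xi).
Proof.
move=> k1 n0 /andP[g0 g1] /andP[d0 d1] /andP[x0 x1].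
have D0 : 0 < (1 - gamma) * delta * xi by rewrite !mulr_gt0// subr_gt0.
have D1 : (1 - gamma) * delta * xi <= 1.
  by rewrite mulr_ile1 ?mulr_ile1 ?mulr_ge0//; lra.
rewrite ler_pdivlMr//; apply: (@le_trans _ _ 2); first by rewrite ler_piMr.
by rewrite (ler_nat _ 2) (leq_trans k1)// leq_pmulr.
Qed.

(** The gap costs delta / 8 and the discretization at most delta / 16. The net has size polynomial
    in Z, so that the Bernstein failures cost at most 390 delta Z^3 Z^-14 <= 390 delta / 512. *)
Lemma failure_bound (S A n N M : nat) (gamma delta xi eta eps : R)
    (Z := (S * A * n)%:R / ((1 - gamma) * delta * xi)) :
  (0 < S)%N -> (1 < A)%N -> (0 < n)%N -> 0 < gamma < 1 -> 0 < delta < 1 -> 0 < xi <= 1 ->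
  eta = delta * (1 - gamma) * xi / (8 * (S * A)%:R) -> eps = (1 - gamma) * eta / 4 ->
  16 * (S * A)%:R / (delta * (1 - gamma) ^+ 2) < N%:R ->
  1 <= (M%:R : R) <= 2 / ((1 - gamma) * eps) + 1 ->
  (S * A)%:R * (eta / (xi * (1 - gamma)) + N%:R^-1) +
    (S%:R + (S * A * M)%:R) * (3 * expR (- (14 * ln Z))) <= delta.
Proof.
move=> S0 A1 n0 Hg Hd Hx etaE epsE HN HM.
have SA1 : (1 < S * A)%N by rewrite (leq_trans A1)// leq_pmull.
have Z2 : 2 <= Z := confidence_arg_ge2 (S * A) n gamma delta xi SA1 n0 Hg Hd Hx.
move: Hg Hd Hx => /andP[g0 g1] /andP[d0 d1] /andP[x0 x1].
have [k kE] : exists k : R, k = (S * A)%:R by exists (S * A)%:R.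
rewrite -kE in etaE HN *.
have k1 : 1 <= k by rewrite kE ler1n ltnW.
have [a aE] : exists a, a = 1 - gamma by exists (1 - gamma).
rewrite -aE in etaE epsE HN HM *.
have a0 : 0 < a by rewrite aE subr_gt0.
have a1 : a <= 1 by rewrite aE; lra.
have Sk : S%:R <= k by rewrite kE ler_nat leq_pmulr// ltnW.
have kM : (S * A * M)%:R = k * M%:R :> R by rewrite kE natrM.
rewrite kM.
have P1 : k * (eta / (xi * a)) = delta / 8 by rewrite etaE; field; lra.
have P2 : k * N%:R^-1 <= delta / 16.
  have N0 : 0 < N%:R :> R.
    by apply: le_lt_trans HN; rewrite divr_ge0 ?mulr_ge0 ?exprn_ge0//; lra.
  rewrite ler_pdivrMr//.
  have d2 : 0 < delta * a ^+ 2 by rewrite mulr_gt0 ?exprn_gt0.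
  move: HN; rewrite ltr_pdivrMr// => HN.
  have : N%:R * (delta * a ^+ 2) <= N%:R * delta.
    by rewrite ler_wpM2l ?(ltW N0)// ger_pMr// expr_le1 ?(ltW a0).
  lra.
have D0 : 0 < a * delta * xi by rewrite !mulr_gt0.
have ZkD : k / (a * delta * xi) <= Z.
  rewrite /Z -aE ler_wpM2r ?invr_ge0 ?(ltW D0)//.
  by rewrite kE ler_nat leq_pmulr.
(* Here k * 2 / (a eps) = 64 k^2 / (a^3 delta xi); comparing with the cube of k / (a delta xi)
   leaves a spare factor delta. *)
have Mb : k * M%:R <= 65 * delta * Z ^+ 3.
  have /andP[_ HM2] := HM.
  apply: (@le_trans _ _ (65 * delta * (k / (a * delta * xi)) ^+ 3)); last first.
    rewrite ler_wpM2l//; first by rewrite mulr_ge0// ltW.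
    by rewrite lerXn2r ?nnegrE//; [rewrite divr_ge0 ?(ltW D0)//; lra|lra].
  apply: (le_trans (ler_wpM2l (_ : 0 <= k) HM2)); first lra.
  pose t := k * (k / (a ^+ 3 * delta * xi)).
  have t0 : 0 <= t.
    by rewrite /t !(mulr_ge0, divr_ge0, exprn_ge0, invr_ge0)// ?ltW//; lra.
  have -> : k * (2 / (a * eps) + 1) = 64 * t + k.
    by rewrite /t epsE etaE; field; lra.
  have -> : 65 * delta * (k / (a * delta * xi)) ^+ 3 = 65 * (t * (k / (delta * xi ^+ 2))).
    by rewrite /t; field; lra.
  have q1 : 1 <= k / (delta * xi ^+ 2).
    rewrite ler_pdivlMr ?mulr_gt0 ?exprn_gt0// mul1r.
    by apply: le_trans k1; rewrite mulr_ile1 ?exprn_ge0 ?exprn_ile1 ?(ltW x0) ?(ltW d0) ?(ltW d1).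
  have kt : k <= t.
    rewrite /t ler_peMr//; first lra.
    rewrite ler_pdivlMr ?mulr_gt0 ?exprn_gt0// mul1r.
    by apply: le_trans k1; rewrite mulr_ile1 ?mulr_ile1 ?mulr_ge0 ?exprn_ge0 ?exprn_ile1 ?(ltW a0)
      ?(ltW x0) ?(ltW d0) ?(ltW d1).
  have := ler_wpM2l t0 q1; lra.
move: Z Z2 ZkD Mb => Z Z2 ZkD Mb.
have -> : expR (- (14 * ln Z)) = Z ^- 14 by rewrite expR_Nln//; lra.
set w := Z ^- 14.
have w0 : 0 < w by rewrite invr_gt0 exprn_gt0//; lra.
have wZ : w * Z ^+ 3 * 2 ^+ 9 <= 1.
  have wE : w * Z ^+ 3 * Z ^+ 11 = 1.
    by rewrite -mulrA -exprD mulVf// expf_eq0/=; apply/eqP; lra.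
  have Z0 : 0 <= Z by lra.
  rewrite -[leRHS]wE; apply: ler_wpM2l; first by rewrite mulr_ge0 ?exprn_ge0 ?(ltW w0).
  apply: (@le_trans _ _ (Z ^+ 9)); first by rewrite lerXn2r ?nnegrE//; lra.
  by rewrite ler_weXn2l//; lra.
have SkM : S%:R + k * M%:R <= 2 * (65 * delta * Z ^+ 3).
  have : k <= k * M%:R by rewrite ler_peMr//; [lra|case/andP: HM].
  lra.
have := ler_wpM2r (_ : 0 <= 3 * w) SkM; rewrite mulr_ge0 ?(ltW w0)// => /(_ isT).
have := ler_wpM2l (ltW d0) wZ.
rewrite mulrDr P1; lra.
Qed.

End Confidence.

Lemma is_policy_unique (R : realType) (S A : nat) (pi pi' : 'I_S -> 'I_A -> R) :
  (A <= 1)%N -> is_policy pi -> is_policy pi' -> pi = pi'.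
Proof.
move=> A1 [_ H] [_ H']; apply/funext => s; apply/funext => a.
have one b : b = a :> 'I_A.
  apply/val_inj; move: (leq_trans (ltn_ord a) A1) (leq_trans (ltn_ord b) A1).
  by rewrite !ltnS !leqn0 => /eqP a0 /eqP b0; rewrite /= a0 b0.
have sumE (f : 'I_A -> R) : \sum_(b < A) f b = f a.
  by rewrite (bigD1 a)//= big1 ?addr0// => b /eqP; case; exact: one.
by have := H s; have := H' s; rewrite !sumE => -> ->.
Qed.

(** * Assembly of the bound *)

(** With two actions or more the argument of the logarithm is at least 2. The event is built before
    pihat is given, so it serves all empirical optimal policies at once. *)
Lemma plug_in_rate (R : realType) (S A n : nat)
    (P : 'I_S -> 'I_A -> 'I_S -> R) (r : 'I_S -> 'I_A -> R)
    (gamma xi delta : R)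
    (d : measure_display) (Omega : measurableType d) (Pr : probability Omega R)
    (X : 'I_S -> 'I_A -> 'I_n -> Omega -> 'I_S) (Delta : 'I_S -> 'I_A -> Omega -> R) :
  (0 < S)%N -> (1 < A)%N -> kernel_ok P -> (forall s a, 0 <= r s a <= 1) ->
  (0 < n)%N -> 0 < gamma < 1 -> 0 < xi <= n%:R^-1 -> 0 < delta < 1 ->
  sampling_model Pr P xi X Delta ->
  exists G : set Omega,
    measurable G /\ ((1 - delta)%:E <= Pr G)%E /\
    forall w, G w ->
      forall pihat, optimal_policy (@Phat R _ _ _ _ _ X w) (rtilde r Delta w) gamma pihat ->
        supnorm (Vpi P r gamma pihat - Vstar P r gamma) <=
        (1 - gamma)^-1 *
        Num.sqrt ((10 ^ 6)%:R * (ln ((S * A * n)%:R / ((1 - gamma) * delta * xi))) ^+ 3 / n%:R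
                  * (spnorm (Vstar P r gamma) + spnorm (Vpi P r gamma pihat) + 1)).
Proof.
move=> S0 A1 HP Hr n0 Hg Hx Hd model.
have /andP[g0 g1] := Hg; have /andP[x0 xn] := Hx; have /andP[d0 d1] := Hd.
have g01 : 0 <= gamma < 1 by rewrite (ltW g0).
have A0 : (0 < A)%N by exact: ltnW.
have HPs := kernel_ok_subkernel _ HP.
have x1 : 0 < xi <= 1.
  by rewrite x0 (le_trans xn)// invf_le1 ?ler1n ?ltr0n.
have a0 : 0 < 1 - gamma by rewrite subr_gt0.
(* Choosing one Bellman solution per MDP makes the leave-one-out policies functions of the outcome;
   outside subkernels the value is arbitrary. *)
have [sol Hsol] : exists sol : ('I_S -> 'I_A -> 'I_S -> R) -> ('I_S -> 'I_A -> R) ->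
    {ffun 'I_S -> 'I_A} * ('I_S -> R),
    forall K rho, subkernel K -> bellman K rho gamma (sol K rho).1 (sol K rho).2.
  have ex (x : ('I_S -> 'I_A -> 'I_S -> R) * ('I_S -> 'I_A -> R)) :
      exists y : {ffun 'I_S -> 'I_A} * ('I_S -> R),
        subkernel x.1 -> bellman x.1 x.2 gamma y.1 y.2.
    have [HK|HK] := pselect (subkernel x.1).
      by have [f [V HB]] := bellman_exists x.1 x.2 gamma A0 HK g01; exists (f, V).
    by exists ([ffun=> Ordinal A0], fun=> 0) => /HK.
  have [sol Hsol] := choice ex.
  by exists (fun K rho => sol (K, rho)) => K rho; exact: (Hsol (K, rho)).
pose Vv (g : {ffun 'I_S -> 'I_A}) := Vpi P r gamma (det_policy g).
pose V g s := Vv g s ord0.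
have VP g : policy_value P r gamma g (V g) by exact: Vpi_det.
have [tm Htm] := choice (fun g => spnorm_shift (Vv g) S0).
pose m g := V g (tm g).
pose B g := spnorm (Vv g) + 1.
pose U g s := V g s - m g.
have B1 g : 1 <= B g by rewrite /B lerDr spnorm_ge0.
have UB g s : 0 <= U g s <= B g by have := Htm g s; rewrite /U /m /V /B; lra.
have Vb g s : 0 <= V g s <= 1 / (1 - gamma) := policy_value_bounds _ _ _ _ _ _ HPs g01 Hr (VP g) s.
have m01 g : 0 <= m g /\ (1 - gamma) * m g <= 1.
  by have /andP[m0 m1] := Vb g (tm g); split=> //; rewrite mulrC -ler_pdivlMr.
set Z := (S * A * n)%:R / ((1 - gamma) * delta * xi).
have SA1 : (1 < S * A)%N by rewrite (leq_trans A1)// leq_pmull.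
have Z2 : 2 <= Z := confidence_arg_ge2 (S * A) n gamma delta xi SA1 n0 Hg Hd x1.
have L2 := ln_ge_half _ Z2; set L := ln Z in L2 *.
pose ell := 14 * L; have ell0 : 0 < ell by rewrite /ell; lra.
pose k := (S * A)%:R : R.
have k1 : 1 <= k by rewrite ler1n ltnW.
(* eta makes the gap failures sum to delta / 8, and eps is half of what [loo_policy_eq]
   tolerates. *)
pose eta := delta * (1 - gamma) * xi / (8 * k).
have eta0 : 0 < eta by rewrite /eta divr_gt0 ?mulr_gt0//; lra.
pose eps := (1 - gamma) * eta / 4.
have ae : 0 < (1 - gamma) * eta by rewrite mulr_gt0.
have eps0 : 0 < eps by rewrite /eps divr_gt0.
have epseta : 2 * eps < (1 - gamma) * eta by rewrite /eps; lra.
(* Exactly large enough that a cell width xi / N satisfies 2 xi / N < (1 - gamma) eta. *)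
pose N := (Num.truncn (16 * k / (delta * (1 - gamma) ^+ 2))).+1.
have N0 : (0 < N)%N by [].
have HN : 16 * k / (delta * (1 - gamma) ^+ 2) < N%:R by exact: truncnS_gt.
(* The grid reaches past 2 / (1 - gamma), which bounds the empirical value since cell rewards are at
   most 2. *)
pose M := (Num.truncn (2 / ((1 - gamma) * eps))).+1.
have b0 : 0 <= 2 / ((1 - gamma) * eps) by rewrite divr_ge0// mulr_ge0 ?ltW.
have HM : 2 / ((1 - gamma) * eps) < M%:R by exact: truncnS_gt.
have HM1 : 1 <= (M%:R : R) <= 2 / ((1 - gamma) * eps) + 1.
  apply/andP; split; first by rewrite ler1n.
  by rewrite /M -natr1 lerD2r; have /andP[] := truncn_itv b0.
pose fs := (sol P r).1.
have HBs : bellman P r gamma fs (sol P r).2 := Hsol P r HPs.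
have VsE : (sol P r).2 = V fs.
  by apply: (policy_value_unique _ _ _ fs _ _ HPs g01) => //; case: HBs.
rewrite VsE in HBs.
have VstarE : Vstar P r gamma = Vv fs.
  by apply/matrixP => s j; rewrite ord1 (Vstar_bellman _ _ _ _ _ HPs g01 HBs).
pose good := @good_outcome R S A n N gamma eta eps ell xi M P r sol U B fs.
exists (\bigcup_(z in [set` good]) outcome_event (xi := xi) (X := X) (Delta := Delta) z).
split; first exact: outcome_bigcup_measurable model good.
split.
  rewrite (outcome_bigcup_prob N0 x0 model) lee_fin.
  apply: le_trans (good_outcome_prob gamma eta eps ell xi M P r sol U B Hsol HP n0 N0 Hg
    eta0 ell0 x0 B1 UB fs).
  rewrite lerD2l lerN2.
  exact: (failure_bound S A n N M gamma delta xi eta eps S0 A1 n0 Hg Hd x1 erefl erefl HN HM1).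
move=> w [z Hz Hw] pihat.
rewrite (outcome_event_Phat _ _ Hw) VstarE.
have HK := emp_kernel_ok n0 z (R := R); set K := emp_kernel z in HK *.
have HKs := kernel_ok_subkernel _ HK.
pose rho := cell_reward xi r z.
have HD s a := outcome_event_Delta N0 x0 z w s a Hw.
have HB := Hsol K rho HKs.
set f := (sol K rho).1 in HB; set Vh := (sol K rho).2 in HB.
have N0' : 0 < N%:R :> R by rewrite ltr0n.
pose c := xi / N%:R.
have c0 : 0 <= c by rewrite divr_ge0 ?(ltW x0).
have Hc : 2 * c < (1 - gamma) * eta.
  rewrite /c /eta; move: HN; rewrite ltr_pdivrMr ?mulr_gt0 ?exprn_gt0// => HN.
  rewrite mulrA ltr_pdivrMr//.
  have k8 : 0 < 8 * k by lra.
  rewrite mulrAC mulrA ltr_pdivlMr//.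
  have := ltr_pM2l x0 (16 * k) (N%:R * (delta * (1 - gamma) ^+ 2)); rewrite HN; lra.
have Hgap s a : a != f s -> qval K rho gamma Vh s a + eta <= Vh s.
  move=> af; have [VhP _] := HB; rewrite [leRHS]VhP.
  exact: (good_outcome_gap _ _ _ _ _ _ _ _ _ _ _ _ _ Hz s (f s) (VhP s)).
have Hrho s a : 0 <= rtilde r Delta w s a - rho s a <= c.
  by have [/andP[_ H1] [H2 _]] := HD s a; rewrite /rtilde /rho /cell_reward /c; lra.
move=> Hopt.
(* pihat is thereby identified with f, the greedy policy of the cell MDP, which depends on z
   alone. *)
have [-> [V' HB']] := optimal_policy_of_gap _ _ _ _ _ _ _ _ _ HKs Hg c0 Hc Hrho HB Hgap Hopt.
rewrite -/(Vv f).
have VhM s : 0 <= Vh s < M%:R * eps.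
  have Hrho2 t a : 0 <= rho t a <= 2.
    have /andP[r0 r1] := Hr t a; have [/andP[H1 H1'] [_ H2]] := HD t a.
    rewrite /rho /cell_reward; case/andP: x1; lra.
  have [VhP _] := HB.
  have /andP[-> /=] := policy_value_bounds _ _ _ _ _ _ HKs g01 Hrho2 VhP s.
  move=> /le_lt_trans; apply; rewrite -ltr_pdivrMr//.
  by have -> : 2 / (1 - gamma) / eps = 2 / ((1 - gamma) * eps) by field; lra.
have Dfs := good_outcome_fixed _ _ _ _ _ _ _ _ _ _ _ _ _ Hz.
have Df := good_outcome_greedy _ _ _ _ _ _ _ _ _ _ _ Hsol n0 Hg eps0 _ _ Hz epseta VhM.
set H := spnorm (Vv fs) + spnorm (Vv f) + 1.
have BH : B fs + B f <= 2 * H.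
  by rewrite /B /H; have := spnorm_ge0 (Vv fs); have := spnorm_ge0 (Vv f); lra.
have T0 := sqrtr_ge0 ((10 ^ 6)%:R * L ^+ 3 / n%:R * H).
have ai : 0 <= (1 - gamma)^-1 by rewrite invr_ge0 ltW.
apply: supnorm_le; first by rewrite mulr_ge0.
move=> s; rewrite mxE [X in _ + X]mxE -/(V f s) -/(V fs s).
have [/andP[ls lf]|lB] := boolP ((ell * B fs <= n%:R) && (ell * B f <= n%:R)); last first.
  (* If either span is too large for n, the trivial error 1 / (1 - gamma) is within the bound. *)
  apply: (@le_trans _ _ ((1 - gamma)^-1)).
    by have := Vb f s; have := Vb fs s; rewrite ler_norml mul1r; lra.
  rewrite ler_peMr//; apply: (rate_trivial n L (B fs) (B f)) => //.
  move: lB; rewrite negb_and -!ltNge -/ell.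
  have := mulr_ge0 (ltW ell0) (le_trans ler01 (B1 fs)).
  have := mulr_ge0 (ltW ell0) (le_trans ler01 (B1 f)).
  by move=> H1 H2 /orP[]; lra.
pose sigma g := Num.sqrt (ell * B g / n%:R).
have He t a : 0 <= Delta t a w <= xi.
  by have [/andP[H1 H2] [_ ->]] := HD t a; rewrite (le_trans H1 H2).
apply: (le_trans (plug_in_error P K r (fun t a => Delta t a w) gamma xi fs (V fs) f V' (V f)
  m B sigma HP HK Hg Hr He HBs HB' (VP f) _ s)).
  move=> g W [[-> ->]|[-> ->]]; split; rewrite ?sqrtr_ge0//; [exact: UB|idtac|exact: UB|idtac].
  - by move=> t; exact: Dfs ls.
  - by move=> t; exact: Df lf.
rewrite mulrC ler_wpM2l//.
exact: (rate_bound n L (B fs) (B f) H xi).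
Qed.

Theorem mainTheorem9 :
  exists C : nat, (0 < C)%N /\
  forall (R : realType) (S A n : nat)
    (P : 'I_S -> 'I_A -> 'I_S -> R) (r : 'I_S -> 'I_A -> R)
    (gamma xi delta : R)
    (d : measure_display) (Omega : measurableType d) (Pr : probability Omega R)
    (X : 'I_S -> 'I_A -> 'I_n -> Omega -> 'I_S) (Delta : 'I_S -> 'I_A -> Omega -> R),
    kernel_ok P ->
    (forall s a, 0 <= r s a <= 1) ->
    (0 < n)%N ->
    0 < gamma < 1 ->
    0 < xi <= n%:R^-1 ->
    0 < delta < 1 ->
    sampling_model Pr P xi X Delta ->
    exists G : set Omega,
      measurable G /\ ((1 - delta)%:E <= Pr G)%E /\
      forall w, G w ->
        forall pihat, optimal_policy (Phat X w) (rtilde r Delta w) gamma pihat ->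
          supnorm (Vpi P r gamma pihat - Vstar P r gamma) <=
          (1 - gamma)^-1 *
          Num.sqrt (C%:R * (ln ((S * A * n)%:R / ((1 - gamma) * delta * xi))) ^+ 3 / n%:R
                    * (spnorm (Vstar P r gamma) + spnorm (Vpi P r gamma pihat) + 1)).
Proof.
exists (10 ^ 6)%N; split; first by rewrite expn_gt0.
(* In the remaining case there is no state or at most one action: all policies coincide, the error
   is zero, and the whole space serves as event. *)
move=> R S A n P r gamma xi delta d Omega Pr X Delta HP Hr n0 Hg Hx Hd model.
have [/andP[S0 A1]|SA] := boolP ((0 < S)%N && (1 < A)%N); first exact: plug_in_rate.
have /andP[g0 g1] := Hg.
exists setT; split; first exact: measurableT.
split; first by rewrite probability_setT lee_fin gerBl; case/andP: Hd => /ltW.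
move=> w _ pihat [Hpi _]; apply: supnorm_le.
  by rewrite mulr_ge0 ?sqrtr_ge0// invr_ge0 subr_ge0 ltW.
move=> s; rewrite (_ : (Vpi P r gamma pihat - Vstar P r gamma) s ord0 = 0) ?normr0
  ?mulr_ge0 ?sqrtr_ge0// ?invr_ge0 ?subr_ge0 ?(ltW g1)//.
have S0 : (0 < S)%N by exact: leq_ltn_trans (ltn_ord s).
have A1 : (A <= 1)%N by move: SA; rewrite S0/= -leqNgt.
(* With no action the weights of pihat at s would sum to 0 instead of 1. *)
have A0 : (0 < A)%N.
  rewrite lt0n; apply/eqP => A0; have [_ /(_ s)] := Hpi.
  rewrite big1 => [/esym/eqP|a _]; first by rewrite oner_eq0.
  by have := ltn_ord a; rewrite [X in (_ < X)%N]A0.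
have HPs := kernel_ok_subkernel _ HP; have g01 : 0 <= gamma < 1 by rewrite (ltW g0).
have [f [V HB]] := bellman_exists P r gamma A0 HPs g01.
have -> : pihat = det_policy f by exact: is_policy_unique A1 Hpi (det_policyP f).
rewrite mxE [X in _ + X]mxE (Vstar_bellman _ _ _ _ _ HPs g01 HB).
have <- := policy_value_unique _ _ _ f _ _ HPs g01 (Vpi_det P r gamma f HPs g01) (proj1 HB).
exact: subrr.
Qed.
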